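(* Let $\omega_0=\min_{|z|=1}\operatorname{Re}\wp(z)$ ($\approx 0.136038$), $\gamma_0=\frac{2}{\pi}\sup_{z\in\mathbb{D}}|\arg\wp(z)|$ ($\approx 0.897828$), and $b=\max_{\theta\in[0,\pi]}T(\theta)$ ($\approx 1.58405$) where $T(\theta)=\dfrac{e^{2\cos\theta}\sin^2(\theta+\sin\theta)}{4(1+e^{\cos\theta}\cos(\theta+\sin\theta))}$. Then: (i) $\mathscr{S}^*_\wp\subset\mathcal{S}^*(\alpha)\subset\mathcal{S}^*$ for $0\le\alpha\le\omega_0$; (ii) $\mathscr{S}^*_\wp\subset\mathcal{M}(\beta)$ for $\beta\ge 1+e$, and $\mathscr{S}^*_\wp\subset\mathcal{S}^*(\omega_0)\cap\mathcal{M}(1+e)$; (iii) $\mathscr{S}^*_\wp\subset\mathcal{SS}^*(\gamma)\subset\mathcal{S}^*$ for $\gamma_0\le\gamma\le 1$; (iv) $\mathscr{S}^*_\wp\subset\mathcal{ST}_p(a)$ for $a\ge b$; (v) $k\text{-}\mathcal{ST}\subset\mathscr{S}^*_\wp$ for $k\ge e-1$.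
   Context: $\mathbb{D}$ is the unit disk; $\mathcal{A}$ is the class of analytic $f$ on $\mathbb{D}$ with $f(0)=0$, $f'(0)=1$. For analytic $f,g$, $f\prec g$ means $f=g\circ\omega$ for some analytic $\omega:\mathbb{D}\to\mathbb{D}$ with $\omega(0)=0$. $\wp(z)=1+ze^z$ and $\mathscr{S}^*_\wp=\{f\in\mathcal{A}: zf'(z)/f(z)\prec\wp(z)\}$. $\mathcal{S}^*(\alpha)=\{f\in\mathcal{A}:\operatorname{Re}(zf'/f)>\alpha\}$, $\mathcal{S}^*=\mathcal{S}^*(0)$; $\mathcal{M}(\beta)=\{f\in\mathcal{A}:\operatorname{Re}(zf'/f)<\beta\}$ ($\beta>1$); $\mathcal{SS}^*(\gamma)=\{f\in\mathcal{A}:|\arg(zf'/f)|<\gamma\pi/2\}$ ($0<\gamma\le1$); $k\text{-}\mathcal{ST}=\{f\in\mathcal{A}:\operatorname{Re}(zf'/f)>k|zf'/f-1|\}$ ($k\ge0$); $\mathcal{ST}_p(a)=\{f\in\mathcal{A}:\operatorname{Re}(zf'/f)+a>|zf'/f-a|\}$ ($a>0$). *)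

(* Defs.v *)
From Stdlib Require Import Reals ClassicalEpsilon.
From Coquelicot Require Import Coquelicot.
Open Scope R_scope.

Definition inD (z : C) : Prop := Cmod z < 1.

Definition analytic_on_D (f : C -> C) : Prop :=
  forall z : C, inD z -> ex_derive f z.

(** the complex derivative f'(z) (meaningful where f is differentiable) *)
Definition Cderive (f : C -> C) (z : C) : C :=
  epsilon (inhabits (RtoC 0)) (fun l : C => is_derive f z l).

Definition classA (f : C -> C) : Prop :=
  analytic_on_D f /\ f (RtoC 0) = RtoC 0 /\ is_derive f (RtoC 0) (RtoC 1).

Definition subordinate (f g : C -> C) : Prop :=
  exists w : C -> C,
    analytic_on_D w /\ (forall z, inD z -> inD (w z)) /\ w (RtoC 0) = RtoC 0 /\
    (forall z, inD z -> f z = g (w z)).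

Definition Cexp (z : C) : C :=
  (exp (Re z) * cos (Im z), exp (Re z) * sin (Im z)).

(** principal argument in (-pi, pi] (atan2), with arg 0 = 0 *)
Definition Carg (w : C) : R :=
  let x := Re w in let y := Im w in
  if Rlt_dec 0 x then atan (y / x)
  else if Rlt_dec x 0 then
    (if Rle_dec 0 y then atan (y / x) + PI else atan (y / x) - PI)
  else if Rlt_dec 0 y then PI / 2
  else if Rlt_dec y 0 then - (PI / 2)
  else 0.

Definition wp (z : C) : C := Cplus (RtoC 1) (Cmult z (Cexp z)).

Definition zq (f : C -> C) (z : C) : C := Cdiv (Cmult z (Cderive f z)) (f z).

(** S*_℘ : f in A and z f'/f (an analytic function on D, extended at 0
    by continuity) is subordinate to ℘ *)
Definition S_wp (f : C -> C) : Prop :=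
  classA f /\
  exists p : C -> C,
    analytic_on_D p /\
    (forall z, inD z -> z <> RtoC 0 -> f z <> RtoC 0 /\ p z = zq f z) /\
    subordinate p wp.

(** For the other classes the condition is imposed at every z in D \ {0}
    (where z f'/f is a genuine quotient; its value at 0 is 1, for which all
    these strict conditions hold automatically under the parameter ranges). *)
Definition S_star_alpha (alpha : R) (f : C -> C) : Prop :=
  classA f /\
  forall z, inD z -> z <> RtoC 0 -> f z <> RtoC 0 /\ alpha < Re (zq f z).

Definition S_star (f : C -> C) : Prop := S_star_alpha 0 f.

Definition M_beta (beta : R) (f : C -> C) : Prop :=
  classA f /\
  forall z, inD z -> z <> RtoC 0 -> f z <> RtoC 0 /\ Re (zq f z) < beta.

Definition SS_star (gamma : R) (f : C -> C) : Prop :=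
  classA f /\
  forall z, inD z -> z <> RtoC 0 ->
    f z <> RtoC 0 /\ Rabs (Carg (zq f z)) < gamma * PI / 2.

Definition k_ST (k : R) (f : C -> C) : Prop :=
  classA f /\
  forall z, inD z -> z <> RtoC 0 ->
    f z <> RtoC 0 /\ k * Cmod (Cminus (zq f z) (RtoC 1)) < Re (zq f z).

Definition ST_p (a : R) (f : C -> C) : Prop :=
  classA f /\
  forall z, inD z -> z <> RtoC 0 ->
    f z <> RtoC 0 /\ Cmod (Cminus (zq f z) (RtoC a)) < Re (zq f z) + a.

Definition is_omega0 (w0 : R) : Prop :=
  (exists z, Cmod z = 1 /\ Re (wp z) = w0) /\
  (forall z, Cmod z = 1 -> w0 <= Re (wp z)).

Definition is_gamma0 (g0 : R) : Prop :=
  is_lub (fun x => exists z, inD z /\ x = Rabs (Carg (wp z))) (g0 * PI / 2).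

Definition Tfun (t : R) : R :=
  exp (2 * cos t) * (sin (t + sin t)) ^ 2 /
  (4 * (1 + exp (cos t) * cos (t + sin t))).

Definition is_bmax (b : R) : Prop :=
  (exists t, 0 <= t <= PI /\ Tfun t = b) /\
  (forall t, 0 <= t <= PI -> Tfun t <= b).

(* Main.v *)
Require Import Defs.
From Stdlib Require Import Reals Lra Classical ClassicalEpsilon.
From Coquelicot Require Import Coquelicot.
Open Scope R_scope.

(** Since wp'(z) = (1 + z) exp z does not vanish on the disk, no function of wp(z) that has no
    critical point of its own has an interior extremum.  So Re wp and (Im wp)^2 - 4 a Re wp are
    controlled by the unit circle, and arg wp does not attain its supremum; this gives (i)-(iv).

    For (v), let L(w) = k |w - 1| - Re w.  On the unit circle L(wp) >= 0, which amounts to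
    exp x - x <= e - 1 on [-1, 1], so the convex domain L < 0 is covered by wp(D).  Moreover wp is
    injective on D because |exp d - 1| <= |d| for Re d <= 0, and the inverse is holomorphic there.

    In (v), and in SS*(gamma) within S*, the quotient z f'/f has to be holomorphic, hence f' too:
    Goursat's theorem on squares yields f(z) N(z) = Phi(z), with N and Phi the Cauchy integrals of
    1 and of f, both of which are differentiated under the integral sign.  Since Carg 0 = 0, the
    zeros of f' must be excluded from SS*(gamma) by a strong minimum principle for Re(z f'/f). *)

(** * Continuity in the plane *)

(** [classA] grants mere complex differentiability, and [Cderive f] is a pointwise choice whose
    continuity is not known beforehand, whereas [S_wp] demands a holomorphic quotient and a
    holomorphic [w]. This gap forces the detour through Cauchy's formula. In the form f N = Phi
    neither the value 2 pi i of N nor its constancy has to be computed: it is enough that N does not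
    vanish at the centre of the square and can be differentiated twice there.

    The constants come from the unit circle. There T is (Im wp)^2 / (4 Re wp), while |w - a| < Re w
    + a describes the inside of the parabola (Im w)^2 = 4 a Re w; so b is the least a whose closed
    parabola contains the image of the circle. The bound e - 1 is dictated by z = -1, where L(wp) =
    (k + 1) / e - 1. All inclusions ask for strict inequalities although the constants are given by
    non-strict bounds; the strictness is gained from the absence of interior extrema. *)

Lemma Cmod_le_abs (z : C) : Cmod z <= Rabs (Re z) + Rabs (Im z).
Proof.
  unfold Cmod, Re, Im.
  assert (H1 := Rabs_pos (fst z)); assert (H2 := Rabs_pos (snd z)).
  rewrite <- (sqrt_pow2 (Rabs (fst z) + Rabs (snd z))) by lra.
  apply sqrt_le_1_alt.
  rewrite <- (pow2_abs (fst z)), <- (pow2_abs (snd z)). nra.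
Qed.

Lemma Im_le_Cmod (z : C) : Rabs (Im z) <= Cmod z.
Proof. eapply Rle_trans; [apply Rmax_r | apply Rmax_Cmod]. Qed.

Lemma Cmod_minus_sym (a b : C) : Cmod (a - b) = Cmod (b - a).
Proof. rewrite <- Cmod_opp; f_equal; ring. Qed.

Lemma Cmod_minus_triangle (a b : C) : Cmod a - Cmod b <= Cmod (a - b).
Proof.
  assert (H := Cmod_triangle (a - b) b).
  replace (a - b + b)%C with a in H by ring. lra.
Qed.

Lemma Cminus_neq_0 (a b : C) : a <> b -> (a - b)%C <> RtoC 0.
Proof. intros H E; apply H. replace a with ((a - b) + b)%C by ring. rewrite E. ring. Qed.

(** The uniform structure on [C] used by [continuous] is that of a product, so its balls are
    squares; passing to disks costs the factor 2 of [Cmod_le_abs]. *)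
Lemma continuous_C_eps (f : C -> C) (z : C) :
  continuous f z <->
  (forall eps, 0 < eps -> exists d, 0 < d /\
     forall y, Cmod (y - z) < d -> Cmod (f y - f z) < eps).
Proof.
  unfold continuous; rewrite filterlim_locally; split.
  - intros H eps He.
    assert (Hs : 0 < eps / 2) by lra.
    destruct (H (mkposreal _ Hs)) as [d Hd].
    exists d; split; [apply d |]. intros y Hy.
    destruct (Hd y) as [H1 H2].
    { split; unfold ball; simpl; unfold AbsRing_ball, abs, minus, plus, opp; simpl.
      - apply (Rle_lt_trans _ _ _ (re_le_Cmod (y - z)) Hy).
      - apply (Rle_lt_trans _ _ _ (Im_le_Cmod (y - z)) Hy). }
    revert H1 H2; unfold ball; simpl; unfold AbsRing_ball, abs, minus, plus, opp; simpl.
    intros H1 H2. apply (Rle_lt_trans _ _ _ (Cmod_le_abs _)).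
    unfold Re, Im; simpl. lra.
  - intros H [eps He].
    destruct (H eps He) as [d [Hd Hy]].
    assert (Hd2 : 0 < d / 2) by lra.
    exists (mkposreal _ Hd2). intros y [H1 H2].
    revert H1 H2; unfold ball; simpl; unfold AbsRing_ball, abs, minus, plus, opp; simpl.
    intros H1 H2.
    assert (Hc : Cmod (f y - f z) < eps).
    { apply Hy. apply (Rle_lt_trans _ _ _ (Cmod_le_abs _)). unfold Re, Im; simpl. lra. }
    split; unfold ball; simpl; unfold AbsRing_ball, abs, minus, plus, opp; simpl.
    + apply (Rle_lt_trans _ _ _ (re_le_Cmod (f y - f z)) Hc).
    + apply (Rle_lt_trans _ _ _ (Im_le_Cmod (f y - f z)) Hc).
Qed.

Lemma continuous_C_R_eps (f : C -> R) (z : C) :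
  continuous f z ->
  forall eps, 0 < eps -> exists d, 0 < d /\
     forall y, Cmod (y - z) < d -> Rabs (f y - f z) < eps.
Proof.
  unfold continuous; rewrite filterlim_locally; intros H eps He.
  destruct (H (mkposreal _ He)) as [d Hd].
  exists d; split; [apply d |]. intros y Hy.
  apply (Hd y). split; unfold ball; simpl; unfold AbsRing_ball, abs, minus, plus, opp; simpl.
  - apply (Rle_lt_trans _ _ _ (re_le_Cmod (y - z)) Hy).
  - apply (Rle_lt_trans _ _ _ (Im_le_Cmod (y - z)) Hy).
Qed.

Lemma continuous_C_pair {U : UniformSpace} (u v : U -> R) (z : U) :
  continuous u z -> continuous v z -> continuous (fun y => (u y, v y) : C) z.
Proof.
  intros Hu Hv. apply filterlim_locally; intros eps.
  apply (filter_and _ _ (proj1 (filterlim_locally _ _) Hu eps)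
                        (proj1 (filterlim_locally _ _) Hv eps)).
Qed.

Lemma continuous_Re {U : UniformSpace} (f : U -> C) (z : U) :
  continuous f z -> continuous (fun y => Re (f y)) z.
Proof.
  intros H. apply (continuous_comp f fst); [exact H |].
  destruct (f z); apply continuous_fst.
Qed.

Lemma continuous_Im {U : UniformSpace} (f : U -> C) (z : U) :
  continuous f z -> continuous (fun y => Im (f y)) z.
Proof.
  intros H. apply (continuous_comp f snd); [exact H |].
  destruct (f z); apply continuous_snd.
Qed.

Lemma continuous_Rplus {U : UniformSpace} (f g : U -> R) (z : U) :
  continuous f z -> continuous g z -> continuous (fun y => f y + g y) z.
Proof. intros; now apply (continuous_plus (V := R_NormedModule)). Qed.

Lemma continuous_Ropp {U : UniformSpace} (f : U -> R) (z : U) :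
  continuous f z -> continuous (fun y => - f y) z.
Proof. intros; now apply (continuous_opp (V := R_NormedModule)). Qed.

Lemma continuous_Rminus {U : UniformSpace} (f g : U -> R) (z : U) :
  continuous f z -> continuous g z -> continuous (fun y => f y - g y) z.
Proof. intros; now apply (continuous_minus (V := R_NormedModule)). Qed.

Lemma continuous_Rmult {U : UniformSpace} (f g : U -> R) (z : U) :
  continuous f z -> continuous g z -> continuous (fun y => f y * g y) z.
Proof. intros; now apply (continuous_mult (K := R_AbsRing)). Qed.

Lemma continuous_Rfct {U : UniformSpace} (h : R -> R) (f : U -> R) (z : U) :
  continuity h -> continuous f z -> continuous (fun y => h (f y)) z.
Proof.
  intros Hh Hf. apply (continuous_comp f h); [exact Hf |].
  apply continuity_pt_filterlim, Hh.
Qed.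

Lemma continuous_Cplus {U : UniformSpace} (f g : U -> C) (z : U) :
  continuous f z -> continuous g z -> continuous (fun y => (f y + g y)%C) z.
Proof.
  intros Hf Hg. apply continuous_C_pair.
  - now apply (continuous_Rplus (fun y => Re (f y)) (fun y => Re (g y))); apply continuous_Re.
  - now apply (continuous_Rplus (fun y => Im (f y)) (fun y => Im (g y))); apply continuous_Im.
Qed.

Lemma continuous_Copp {U : UniformSpace} (f : U -> C) (z : U) :
  continuous f z -> continuous (fun y => (- f y)%C) z.
Proof.
  intros Hf. apply continuous_C_pair.
  - now apply (continuous_Ropp (fun y => Re (f y))), continuous_Re.
  - now apply (continuous_Ropp (fun y => Im (f y))), continuous_Im.
Qed.

Lemma continuous_Cminus {U : UniformSpace} (f g : U -> C) (z : U) :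
  continuous f z -> continuous g z -> continuous (fun y => (f y - g y)%C) z.
Proof. intros; apply continuous_Cplus; [| apply continuous_Copp]; assumption. Qed.

Lemma continuous_Cmult {U : UniformSpace} (f g : U -> C) (z : U) :
  continuous f z -> continuous g z -> continuous (fun y => (f y * g y)%C) z.
Proof.
  intros Hf Hg.
  assert (Hf1 := continuous_Re f z Hf). assert (Hf2 := continuous_Im f z Hf).
  assert (Hg1 := continuous_Re g z Hg). assert (Hg2 := continuous_Im g z Hg).
  apply continuous_C_pair.
  - apply (continuous_Rminus (fun y => Re (f y) * Re (g y)) (fun y => Im (f y) * Im (g y)));
      apply continuous_Rmult; assumption.
  - apply (continuous_Rplus (fun y => Re (f y) * Im (g y)) (fun y => Im (f y) * Re (g y)));
      apply continuous_Rmult; assumption.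
Qed.

Lemma continuous_Cinv {U : UniformSpace} (f : U -> C) (z : U) :
  f z <> RtoC 0 -> continuous f z -> continuous (fun y => (/ f y)%C) z.
Proof.
  intros H0 Hf.
  assert (Hr := continuous_Re f z Hf). assert (Hi := continuous_Im f z Hf).
  assert (Hn : 0 < Re (f z) ^ 2 + Im (f z) ^ 2).
  { rewrite <- Cmod2_alt. apply pow_lt. now apply Cmod_gt_0. }
  assert (Hd : continuous (fun y => / (Re (f y) ^ 2 + Im (f y) ^ 2)) z).
  { apply (continuous_comp (fun y => Re (f y) ^ 2 + Im (f y) ^ 2) Rinv).
    - apply continuous_Rplus;
        apply (continuous_Rfct (fun x => x ^ 2)); trivial;
        apply derivable_continuous, derivable_pow.
    - apply continuous_Rinv. lra. }
  apply continuous_C_pair; apply continuous_Rmult; trivial; now apply continuous_Ropp.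
Qed.

Lemma continuous_Cmod {U : UniformSpace} (f : U -> C) (z : U) :
  continuous f z -> continuous (fun y => Cmod (f y)) z.
Proof.
  intros Hf. apply (continuous_comp (fun y => Re (f y) ^ 2 + Im (f y) ^ 2) sqrt).
  - apply continuous_Rplus; apply (continuous_Rfct (fun x => x ^ 2));
      try apply derivable_continuous, derivable_pow;
      [now apply continuous_Re | now apply continuous_Im].
  - apply continuous_sqrt.
Qed.

(** * Complex derivatives *)

(* Caratheodory's form of the derivative: its slope function phi makes the
   differentiation rules purely algebraic. *)
Definition cdiff (f : C -> C) (z l : C) : Prop :=
  exists phi : C -> C,
    continuous phi z /\ phi z = l /\
    exists d, 0 < d /\ forall y, Cmod (y - z) < d -> f y = (f z + phi y * (y - z))%C.

Lemma cdiff_eps (f : C -> C) (z l : C) :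
  cdiff f z l <->
  (forall eps, 0 < eps -> exists d, 0 < d /\
     forall y, Cmod (y - z) < d -> Cmod (f y - f z - l * (y - z)) <= eps * Cmod (y - z)).
Proof.
  split.
  - intros [phi [Hc [Hl [d [Hd H]]]]] eps He.
    destruct (proj1 (continuous_C_eps _ _) Hc eps He) as [d' [Hd' H']].
    exists (Rmin d d'); split; [now apply Rmin_glb_lt |]. intros y Hy.
    rewrite (H y) by (eapply Rlt_le_trans; [exact Hy | apply Rmin_l]).
    replace (f z + phi y * (y - z) - f z - l * (y - z))%C
      with ((phi y - phi z) * (y - z))%C by (rewrite Hl; ring).
    rewrite Cmod_mult. apply Rmult_le_compat_r; [apply Cmod_ge_0 |].
    left; apply H'. eapply Rlt_le_trans; [exact Hy | apply Rmin_r].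
  - intros H.
    exists (fun y => if excluded_middle_informative (y = z) then l
                     else ((f y - f z) / (y - z))%C).
    destruct (excluded_middle_informative (z = z)) as [_ | n]; [| now destruct n].
    repeat split.
    + apply continuous_C_eps. intros eps He.
      destruct (excluded_middle_informative (z = z)) as [_ | n]; [| now destruct n].
      destruct (H (eps / 2) ltac:(lra)) as [d [Hd Hy]].
      exists d; split; trivial. intros y Hyd.
      destruct (excluded_middle_informative (y = z)) as [-> | n].
      * replace (l - l)%C with (RtoC 0) by ring. now rewrite Cmod_0.
      * assert (n' := Cminus_neq_0 _ _ n).
        assert (Hp := proj1 (Cmod_gt_0 _) n').
        specialize (Hy y Hyd).
        replace (f y - f z - l * (y - z))%C
          with (((f y - f z) / (y - z) - l) * (y - z))%C in Hy by (field; trivial).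
        rewrite Cmod_mult in Hy. apply Rmult_le_reg_r in Hy; lra.
    + exists 1; split; [lra |]. intros y _.
      destruct (excluded_middle_informative (y = z)) as [-> | n]; [ring |].
      assert (n' := Cminus_neq_0 _ _ n). field. trivial.
Qed.

Lemma is_derive_cdiff (f : C -> C) (z l : C) : is_derive f z l <-> cdiff f z l.
Proof.
  rewrite cdiff_eps. split.
  - intros [_ H] eps He.
    specialize (H z (fun P HP => HP) (mkposreal _ He)).
    destruct H as [d Hd]. exists d; split; [apply d |].
    intros y Hy. specialize (Hd y Hy). rewrite (Cmult_comm l). apply Hd.
  - intros H. split; [apply is_linear_scal_l |].
    intros x Hx. assert (Ex := is_filter_lim_locally_unique _ _ Hx). subst x.
    intros [eps He]. destruct (H eps He) as [d [Hd Hy]].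
    exists (mkposreal _ Hd). intros y Hyd.
    assert (G := Hy y Hyd). rewrite (Cmult_comm l) in G. apply G.
Qed.

Lemma cdiff_continuous (f : C -> C) (z l : C) : cdiff f z l -> continuous f z.
Proof.
  intros [phi [Hc [_ [d [Hd H]]]]].
  apply (continuous_ext_loc _ (fun y => (f z + phi y * (y - z))%C)).
  - assert (Hd2 : 0 < d / 2) by lra. exists (mkposreal _ Hd2). intros y [H1 H2].
    symmetry; apply H. apply (Rle_lt_trans _ _ _ (Cmod_le_abs _)).
    revert H1 H2; unfold ball; simpl; unfold AbsRing_ball, abs, minus, plus, opp; simpl.
    unfold Re, Im; simpl; lra.
  - apply continuous_Cplus; [apply continuous_const |].
    apply continuous_Cmult; trivial.
    apply continuous_Cminus; [apply continuous_id | apply continuous_const].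
Qed.

Lemma cdiff_ext_loc (f g : C -> C) (z l : C) d :
  0 < d -> (forall y, Cmod (y - z) < d -> f y = g y) -> cdiff f z l -> cdiff g z l.
Proof.
  intros Hd E [phi [Hc [Hl [d' [Hd' H]]]]]. exists phi; repeat split; trivial.
  exists (Rmin d d'); split; [now apply Rmin_glb_lt |]. intros y Hy.
  rewrite <- !E.
  - apply H. eapply Rlt_le_trans; [exact Hy | apply Rmin_r].
  - replace (z - z)%C with (RtoC 0) by ring. now rewrite Cmod_0.
  - eapply Rlt_le_trans; [exact Hy | apply Rmin_l].
Qed.

Lemma cdiff_unique (f : C -> C) (z l1 l2 : C) : cdiff f z l1 -> cdiff f z l2 -> l1 = l2.
Proof.
  intros H1 H2.
  transitivity (C_derive f z); [symmetry |]; now apply is_C_derive_unique, is_derive_cdiff.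
Qed.

Lemma cdiff_const (c z : C) : cdiff (fun _ => c) z (RtoC 0).
Proof.
  exists (fun _ => RtoC 0); repeat split; [apply continuous_const |].
  exists 1; split; [lra |]. intros; ring.
Qed.

Lemma cdiff_id (z : C) : cdiff (fun y => y) z (RtoC 1).
Proof.
  exists (fun _ => RtoC 1); repeat split; [apply continuous_const |].
  exists 1; split; [lra |]. intros; ring.
Qed.

Lemma cdiff_plus (f g : C -> C) (z lf lg : C) :
  cdiff f z lf -> cdiff g z lg -> cdiff (fun y => (f y + g y)%C) z (lf + lg)%C.
Proof.
  intros [p [Hp [El [d [Hd H]]]]] [q [Hq [El' [d' [Hd' H']]]]].
  exists (fun y => (p y + q y)%C). rewrite El, El'. repeat split.
  - now apply continuous_Cplus.
  - exists (Rmin d d'); split; [now apply Rmin_glb_lt |]. intros y Hy.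
    rewrite H, H'; [ring | |]; eapply Rlt_le_trans; try exact Hy; [apply Rmin_r | apply Rmin_l].
Qed.

Lemma cdiff_mult (f g : C -> C) (z lf lg : C) :
  cdiff f z lf -> cdiff g z lg ->
  cdiff (fun y => (f y * g y)%C) z (lf * g z + f z * lg)%C.
Proof.
  intros Df Dg. assert (Cg := cdiff_continuous _ _ _ Dg).
  destruct Df as [p [Hp [El [d [Hd H]]]]], Dg as [q [Hq [El' [d' [Hd' H']]]]].
  exists (fun y => (p y * g y + f z * q y)%C). rewrite El, El'. repeat split.
  - apply continuous_Cplus; apply continuous_Cmult; trivial; apply continuous_const.
  - exists (Rmin d d'); split; [now apply Rmin_glb_lt |]. intros y Hy.
    rewrite H, H'; [ring | |]; eapply Rlt_le_trans; try exact Hy; [apply Rmin_r | apply Rmin_l].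
Qed.

Lemma cdiff_scal (c : C) (f : C -> C) (z l : C) :
  cdiff f z l -> cdiff (fun y => (c * f y)%C) z (c * l)%C.
Proof.
  intros H. replace (c * l)%C with (RtoC 0 * f z + c * l)%C by ring.
  apply (cdiff_mult (fun _ => c)); [apply cdiff_const | exact H].
Qed.

Lemma cdiff_minus (f g : C -> C) (z lf lg : C) :
  cdiff f z lf -> cdiff g z lg -> cdiff (fun y => (f y - g y)%C) z (lf - lg)%C.
Proof.
  intros Hf Hg.
  apply (cdiff_ext_loc (fun y => (f y + - RtoC 1 * g y)%C) _ _ _ 1); [lra | |].
  - intros. ring.
  - replace (lf - lg)%C with (lf + - RtoC 1 * lg)%C by ring.
    apply cdiff_plus; trivial. now apply cdiff_scal.
Qed.

Lemma cdiff_inv (f : C -> C) (z l : C) :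
  f z <> RtoC 0 -> cdiff f z l -> cdiff (fun y => (/ f y)%C) z (- l / (f z * f z))%C.
Proof.
  intros H0 Df. assert (Cf := cdiff_continuous _ _ _ Df).
  destruct (proj1 (continuous_C_eps _ _) Cf (Cmod (f z))) as [d' [Hd' H']].
  { now apply Cmod_gt_0. }
  destruct Df as [p [Hp [El [d [Hd H]]]]].
  exists (fun y => (- p y * (/ f y * / f z))%C). repeat split.
  - apply continuous_Cmult; [now apply continuous_Copp |].
    apply continuous_Cmult; [now apply continuous_Cinv | apply continuous_const].
  - rewrite El. field; trivial.
  - exists (Rmin d d'); split; [now apply Rmin_glb_lt |]. intros y Hy.
    assert (Hn : f y <> RtoC 0).
    { intros E. specialize (H' y). rewrite E in H'.
      replace (0 - f z)%C with (- f z)%C in H' by ring. rewrite Cmod_opp in H'.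
      apply (Rlt_irrefl (Cmod (f z))), H'. eapply Rlt_le_trans; [exact Hy | apply Rmin_r]. }
    assert (E : f y = (f z + p y * (y - z))%C)
      by (apply H; eapply Rlt_le_trans; [exact Hy | apply Rmin_l]).
    assert (E2 : (p y * (y - z))%C = (f y - f z)%C) by (rewrite E; ring).
    replace (- p y * (/ f y * / f z) * (y - z))%C
      with (- (p y * (y - z)) * (/ f y * / f z))%C by ring.
    rewrite E2. field; split; trivial.
Qed.

(** This is the passage to real calculus: the mean value bounds, the second derivative test and the
    descent arguments are all applied to restrictions to lines. *)
Lemma cdiff_line (f : C -> C) (a v l : C) (t : R) :
  cdiff f (a + RtoC t * v)%C l ->
  is_derive (fun s => Re (f (a + RtoC s * v)%C)) t (Re (l * v)%C) /\
  is_derive (fun s => Im (f (a + RtoC s * v)%C)) t (Im (l * v)%C).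
Proof.
  rewrite cdiff_eps. intros H.
  assert (G : forall eps, 0 < eps -> exists d : posreal, forall h, h <> 0 -> Rabs h < d ->
     Cmod ((f (a + RtoC (t + h) * v) - f (a + RtoC t * v)) / RtoC h - l * v)%C < eps).
  { intros eps He.
    assert (Hv := Cmod_ge_0 v).
    assert (Hq : 0 < eps / (2 * (Cmod v + 1))) by (apply Rdiv_lt_0_compat; lra).
    destruct (H _ Hq) as [d [Hd Hy]].
    assert (Hd2 : 0 < d / (Cmod v + 1)) by (apply Rdiv_lt_0_compat; lra).
    exists (mkposreal _ Hd2). simpl. intros h Hh Hhd.
    assert (Hh' : RtoC h <> RtoC 0) by (intros E; apply Hh; now injection E).
    assert (Ey : (a + RtoC (t + h) * v - (a + RtoC t * v))%C = (RtoC h * v)%C)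
      by (rewrite RtoC_plus; ring).
    specialize (Hy (a + RtoC (t + h) * v)%C). rewrite Ey in Hy.
    rewrite Cmod_mult, Cmod_R in Hy.
    assert (Hh0 := Rabs_pos_lt h Hh).
    assert (Hs : Rabs h * (Cmod v + 1) < d).
    { apply (Rmult_lt_compat_r (Cmod v + 1)) in Hhd; [| lra].
      unfold Rdiv in Hhd. rewrite Rmult_assoc, Rinv_l in Hhd by lra. lra. }
    specialize (Hy ltac:(nra)).
    replace ((f (a + RtoC (t + h) * v) - f (a + RtoC t * v)) / RtoC h - l * v)%C
      with ((f (a + RtoC (t + h) * v) - f (a + RtoC t * v) - l * (RtoC h * v)) / RtoC h)%C
      by (field; trivial).
    rewrite Cmod_div, Cmod_R by trivial.
    apply (Rmult_lt_reg_r (Rabs h)); trivial.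
    unfold Rdiv; rewrite Rmult_assoc, Rinv_l, Rmult_1_r by lra.
    eapply Rle_lt_trans; [exact Hy |].
    assert (Hr : eps / (2 * (Cmod v + 1)) * (Cmod v + 1) = eps / 2) by (field; lra).
    assert (eps / (2 * (Cmod v + 1)) * Cmod v < eps) by nra.
    nra. }
  split; apply is_derive_Reals; intros eps He; destruct (G eps He) as [d Hd];
    exists d; intros h Hh Hhd; specialize (Hd h Hh Hhd);
    assert (Hh' : RtoC h <> RtoC 0) by (intros E; apply Hh; now injection E).
  - eapply Rle_lt_trans; [| exact Hd]. eapply Rle_trans; [| apply re_le_Cmod].
    right. f_equal. unfold Re, Im; simpl. field. trivial.
  - eapply Rle_lt_trans; [| exact Hd]. eapply Rle_trans; [| apply Im_le_Cmod].
    right. f_equal. unfold Re, Im; simpl. field. trivial.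
Qed.

(** * Bisection of rectangles *)

Lemma nested_intervals (a b : nat -> R) :
  (forall n, a n <= a (S n)) -> (forall n, b (S n) <= b n) -> (forall n, a n <= b n) ->
  exists c, forall n, a n <= c <= b n.
Proof.
  intros Ha Hb Hab.
  assert (Hai : forall n k, a n <= a (n + k)%nat).
  { intros n k; induction k; [rewrite Nat.add_0_r; lra |].
    rewrite Nat.add_succ_r. specialize (Ha (n + k)%nat). lra. }
  assert (Hbi : forall n k, b (n + k)%nat <= b n).
  { intros n k; induction k; [rewrite Nat.add_0_r; lra |].
    rewrite Nat.add_succ_r. specialize (Hb (n + k)%nat). lra. }
  assert (Hm : forall n m, a n <= b m).
  { intros n m. specialize (Hai n m). specialize (Hbi m n). specialize (Hab (n + m)%nat).
    rewrite (Nat.add_comm m n) in Hbi. lra. }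
  destruct (completeness (fun x => exists n, x = a n)) as [c [Hc1 Hc2]].
  - exists (b 0%nat). intros x [n ->]. apply Hm.
  - exists (a 0%nat). now exists 0%nat.
  - exists c. intros n; split.
    + apply Hc1. now exists n.
    + apply Hc2. intros x [k ->]. apply Hm.
Qed.

(** Compactness of a rectangle in the form of an induction principle. If [P] failed, one quarter
    would fail at every stage of the bisection; the quarters shrink to a point, and the local
    validity of [P] there is contradicted. Both the extreme value theorem and Goursat's estimate are
    instances. *)
Lemma rectangle_bisection (P : R -> R -> R -> R -> Prop) (x y w h : R) :
  0 <= w -> 0 <= h ->
  (forall x y w h, 0 <= w -> 0 <= h ->
     P x y (w / 2) (h / 2) -> P (x + w / 2) y (w / 2) (h / 2) ->
     P x (y + h / 2) (w / 2) (h / 2) -> P (x + w / 2) (y + h / 2) (w / 2) (h / 2) ->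
     P x y w h) ->
  (forall cx cy, x <= cx <= x + w -> y <= cy <= y + h ->
     exists d, 0 < d /\ forall x' y' w' h',
       x' <= cx <= x' + w' -> y' <= cy <= y' + h' -> w' < d -> h' < d -> P x' y' w' h') ->
  P x y w h.
Proof.
  intros Hw Hh Hquad Hloc. apply NNPP; intros Hn.
  set (W n := w / 2 ^ n). set (H n := h / 2 ^ n).
  assert (HW : forall n, 0 <= W n /\ W (S n) = W n / 2).
  { intros n. assert (0 < 2 ^ n) by (apply pow_lt; lra). split; unfold W; simpl.
    - apply Rdiv_le_0_compat; lra.
    - field; lra. }
  assert (HH : forall n, 0 <= H n /\ H (S n) = H n / 2).
  { intros n. assert (0 < 2 ^ n) by (apply pow_lt; lra). split; unfold H; simpl.
    - apply Rdiv_le_0_compat; lra.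
    - field; lra. }
  (* [s'] is the lower left corner of a failing quarter of the rectangle at [s]; these bounds on the
     corners suffice for nested intervals, because the sides are halved. *)
  set (Q n (s s' : R * R) :=
    (fst s <= fst s' <= fst s + W (S n)) /\ (snd s <= snd s' <= snd s + H (S n)) /\
    ~ P (fst s') (snd s') (W (S n)) (H (S n))).
  assert (Hstep : forall n s, ~ P (fst s) (snd s) (W n) (H n) -> exists s', Q n s s').
  { intros n [a b] Hab; simpl in Hab.
    destruct (HW n) as [Hw0 Hw1], (HH n) as [Hh0 Hh1].
    unfold Q; rewrite Hw1, Hh1; simpl.
    apply NNPP; intros He. apply Hab, Hquad; trivial; apply NNPP; intros Hp; apply He.
    - exists (a, b); simpl. repeat split; trivial; lra.
    - exists (a + W n / 2, b); simpl. repeat split; trivial; lra.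
    - exists (a, b + H n / 2); simpl. repeat split; trivial; lra.
    - exists (a + W n / 2, b + H n / 2); simpl. repeat split; trivial; lra. }
  set (u := nat_rect (fun _ => (R * R)%type) (x, y) (fun n s => epsilon (inhabits s) (Q n s))).
  assert (Hu : forall n, ~ P (fst (u n)) (snd (u n)) (W n) (H n)).
  { induction n as [| n IH].
    - simpl. unfold W, H; simpl. now replace (w / 1) with w by field; replace (h / 1) with h by field.
    - exact (proj2 (proj2 (epsilon_spec (inhabits (u n)) (Q n (u n)) (Hstep n (u n) IH)))). }
  assert (HQ : forall n, Q n (u n) (u (S n))).
  { intros n. exact (epsilon_spec (inhabits (u n)) (Q n (u n)) (Hstep n (u n) (Hu n))). }
  destruct (nested_intervals (fun n => fst (u n)) (fun n => fst (u n) + W n)) as [cx Hcx].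
  { intros n; apply HQ. }
  { intros n. destruct (HQ n) as [Hq _], (HW n) as [_ Hq']. lra. }
  { intros n. destruct (HW n). lra. }
  destruct (nested_intervals (fun n => snd (u n)) (fun n => snd (u n) + H n)) as [cy Hcy].
  { intros n; apply HQ. }
  { intros n. destruct (HQ n) as [_ [Hq _]], (HH n) as [_ Hq']. lra. }
  { intros n. destruct (HH n). lra. }
  destruct (Hloc cx cy) as [d [Hd Hp]].
  { specialize (Hcx 0%nat). unfold W in Hcx; simpl in Hcx. lra. }
  { specialize (Hcy 0%nat). unfold H in Hcy; simpl in Hcy. lra. }
  assert (Hsmall : exists n, W n < d /\ H n < d).
  { destruct (pow_lt_1_zero (1 / 2)) with (y := d / (w + h + 1)) as [n Hn'].
    - rewrite Rabs_pos_eq; lra.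
    - apply Rdiv_lt_0_compat; lra.
    - specialize (Hn' n (Nat.le_refl n)). exists n.
      assert (Hp2 : 0 < (1 / 2) ^ n) by (apply pow_lt; lra).
      rewrite Rabs_pos_eq in Hn' by lra.
      assert (E : forall v, v / 2 ^ n = v * (1 / 2) ^ n).
      { intros v. unfold Rdiv. rewrite Rmult_1_l, pow_inv. reflexivity. }
      unfold W, H; rewrite !E.
      apply (Rmult_lt_compat_r (w + h + 1)) in Hn'; [| lra].
      unfold Rdiv in Hn' at 2. rewrite Rmult_assoc, Rinv_l in Hn' by lra.
      split; nra. }
  destruct Hsmall as [n [H1 H2]].
  exact (Hu n (Hp _ _ _ _ (Hcx n) (Hcy n) H1 H2)).
Qed.

(** * Extreme values on compact sets of the plane *)

(** Without a minimum, on every small rectangle a single point of [S] is strictly better than all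
    points of [S] in that rectangle: by continuity around a point of [S], vacuously around a point
    off the closed set [S]. Bisection extends this to the square of half-side [B], where the better
    point would have to be better than itself. *)
Lemma continuous_attains_min (S : C -> Prop) (F : C -> R) (B : R) :
  (exists z, S z) -> (forall z, S z -> Cmod z <= B) ->
  (forall z, ~ S z -> exists d, 0 < d /\ forall y, Cmod (y - z) < d -> ~ S y) ->
  (forall z, S z -> continuous F z) ->
  exists z, S z /\ forall y, S y -> F z <= F y.
Proof.
  intros [s0 Hs0] HB Hcl Hc. apply NNPP; intros Hn.
  assert (Hlow : forall z, S z -> exists y, S y /\ F y < F z).
  { intros z Hz. apply NNPP; intros Hz'. apply Hn. exists z; split; trivial.
    intros y Hy. apply Rnot_lt_le; intros Hyz. apply Hz'. now exists y. }
  assert (HB0 : 0 <= B) by (apply (Rle_trans _ (Cmod s0)); [apply Cmod_ge_0 | auto]).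
  set (P x y w h := exists y0, S y0 /\
    forall a b, x <= a <= x + w -> y <= b <= y + h -> S (a, b) -> F y0 < F (a, b)).
  assert (Hmin : forall Q1 Q2 : C -> Prop,
    (exists y0, S y0 /\ forall z, Q1 z -> F y0 < F z) ->
    (exists y0, S y0 /\ forall z, Q2 z -> F y0 < F z) ->
    exists y0, S y0 /\ forall z, Q1 z \/ Q2 z -> F y0 < F z).
  { intros Q1 Q2 [y1 [Hy1 H1]] [y2 [Hy2 H2]].
    destruct (Rle_lt_dec (F y1) (F y2)) as [Hl | Hl];
      [exists y1 | exists y2]; split; trivial; intros z [Hz | Hz];
      specialize (H1 z); specialize (H2 z); intuition lra. }
  assert (HP : P (- B) (- B) (2 * B) (2 * B)).
  { apply rectangle_bisection; try lra.
    - intros x y w h Hw Hh P1 P2 P3 P4.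
      pose (Q x y w h (z : C) := x <= Re z <= x + w /\ y <= Im z <= y + h /\ S z).
      assert (HQ : forall x y w h, P x y w h ->
        exists y0, S y0 /\ forall z, Q x y w h z -> F y0 < F z).
      { intros x' y' w' h' [y0 [Hy0 Hy]]. exists y0; split; trivial.
        intros [a b] [H1 [H2 H3]]. now apply Hy. }
      destruct (Hmin _ _ (Hmin _ _ (HQ _ _ _ _ P1) (HQ _ _ _ _ P2))
                         (Hmin _ _ (HQ _ _ _ _ P3) (HQ _ _ _ _ P4))) as [y0 [Hy0 Hy]].
      exists y0; split; trivial. intros a b Ha Hb Hab. apply Hy. unfold Q, Re, Im; simpl.
      destruct (Rle_lt_dec a (x + w / 2)), (Rle_lt_dec b (y + h / 2)).
      + left; left; repeat split; trivial; lra.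
      + right; left; repeat split; trivial; lra.
      + left; right; repeat split; trivial; lra.
      + right; right; repeat split; trivial; lra.
    - intros cx cy _ _.
      assert (Hnear : forall d x' y' w' h' a b,
        x' <= cx <= x' + w' -> y' <= cy <= y' + h' -> w' < d / 2 -> h' < d / 2 ->
        x' <= a <= x' + w' -> y' <= b <= y' + h' -> Cmod ((a, b) - (cx, cy))%C < d).
      { intros. apply (Rle_lt_trans _ _ _ (Cmod_le_abs _)). unfold Re, Im; simpl.
        assert (Rabs (a + - cx) < d / 2) by (apply Rabs_def1; lra).
        assert (Rabs (b + - cy) < d / 2) by (apply Rabs_def1; lra). lra. }
      destruct (classic (S (cx, cy))) as [Hs | Hs].
      + destruct (Hlow _ Hs) as [y0 [Hy0 Hlt]].
        destruct (continuous_C_R_eps F _ (Hc _ Hs) (F (cx, cy) - F y0)) as [d [Hd Hd']]; [lra |].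
        exists (d / 2); split; [lra |]. intros x' y' w' h' H1 H2 H3 H4.
        exists y0; split; trivial. intros a b Ha Hb _.
        specialize (Hd' (a, b) (Hnear d _ _ _ _ _ _ H1 H2 H3 H4 Ha Hb)).
        apply Rabs_def2 in Hd'. lra.
      + destruct (Hcl _ Hs) as [d [Hd Hd']].
        exists (d / 2); split; [lra |]. intros x' y' w' h' H1 H2 H3 H4.
        exists s0; split; trivial. intros a b Ha Hb Hab.
        destruct (Hd' (a, b) (Hnear d _ _ _ _ _ _ H1 H2 H3 H4 Ha Hb) Hab). }
  destruct HP as [y0 [Hy0 Hy]].
  assert (H1 := Rle_trans _ _ _ (re_le_Cmod y0) (HB _ Hy0)).
  assert (H2 := Rle_trans _ _ _ (Im_le_Cmod y0) (HB _ Hy0)).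
  destruct y0 as [a b]. apply (Rlt_irrefl (F (a, b))), Hy; trivial.
  - apply Rabs_le_between in H1. unfold Re in H1; simpl in H1. lra.
  - apply Rabs_le_between in H2. unfold Im in H2; simpl in H2. lra.
Qed.

(** * Goursat's theorem for rectangles *)

Definition CInt (h : R -> C) (a b : R) : C := @RInt C_R_CompleteNormedModule h a b.

Definition continuous_on_itv (h : R -> C) (a b : R) : Prop :=
  forall t, a <= t <= b -> continuous h t.

Lemma CInt_correct (h : R -> C) (a b : R) :
  a <= b -> continuous_on_itv h a b -> @is_RInt C_R_NormedModule h a b (CInt h a b).
Proof.
  intros Hab Hc. apply (@RInt_correct C_R_CompleteNormedModule).
  apply (@ex_RInt_continuous C_R_CompleteNormedModule).
  rewrite Rmin_left, Rmax_right by trivial. exact Hc.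
Qed.

Lemma CInt_unique (h : R -> C) (a b : R) (l : C) :
  @is_RInt C_R_NormedModule h a b l -> CInt h a b = l.
Proof. apply (@is_RInt_unique C_R_CompleteNormedModule). Qed.

Lemma CInt_ext (h g : R -> C) (a b : R) :
  a <= b -> (forall t, a <= t <= b -> h t = g t) -> CInt h a b = CInt g a b.
Proof.
  intros Hab H. apply (@RInt_ext C_R_CompleteNormedModule). rewrite Rmin_left, Rmax_right by trivial.
  intros t Ht; apply H; lra.
Qed.

Lemma CInt_plus (h g : R -> C) (a b : R) :
  a <= b -> continuous_on_itv h a b -> continuous_on_itv g a b ->
  CInt (fun t => (h t + g t)%C) a b = (CInt h a b + CInt g a b)%C.
Proof.
  intros. apply CInt_unique.
  apply (@is_RInt_plus C_R_NormedModule); now apply CInt_correct.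
Qed.

(** The integral lives in [C] as a real normed module, so linearity is available for real factors; a
    complex factor is treated through the components. *)
Lemma CInt_scal (c : C) (h : R -> C) (a b : R) :
  a <= b -> continuous_on_itv h a b -> CInt (fun t => (c * h t)%C) a b = (c * CInt h a b)%C.
Proof.
  intros Hab Hc. apply CInt_unique. assert (Hi := CInt_correct h a b Hab Hc).
  assert (H1 := is_RInt_fct_extend_fst _ _ _ _ Hi).
  assert (H2 := is_RInt_fct_extend_snd _ _ _ _ Hi).
  apply (@is_RInt_fct_extend_pair R_NormedModule R_NormedModule).
  - apply (@is_RInt_minus R_NormedModule); now apply (@is_RInt_scal R_NormedModule).
  - apply (@is_RInt_plus R_NormedModule); now apply (@is_RInt_scal R_NormedModule).
Qed.

Lemma CInt_minus (h g : R -> C) (a b : R) :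
  a <= b -> continuous_on_itv h a b -> continuous_on_itv g a b ->
  CInt (fun t => (h t - g t)%C) a b = (CInt h a b - CInt g a b)%C.
Proof.
  intros. apply CInt_unique.
  apply (@is_RInt_minus C_R_NormedModule); now apply CInt_correct.
Qed.

Lemma CInt_const (c : C) (a b : R) : CInt (fun _ => c) a b = (RtoC (b - a) * c)%C.
Proof.
  unfold CInt. rewrite (@RInt_const C_R_CompleteNormedModule).
  destruct c as [u v]. apply injective_projections; unfold scal; simpl;
    unfold prod_scal, scal; simpl; unfold mult; simpl; ring.
Qed.

Lemma CInt_Chasles (h : R -> C) (a m b : R) :
  a <= m <= b -> continuous_on_itv h a b -> CInt h a b = (CInt h a m + CInt h m b)%C.
Proof.
  intros Hm Hc. apply CInt_unique.
  apply (@is_RInt_Chasles C_R_NormedModule h a m b);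
    apply CInt_correct; try lra; intros t Ht; apply Hc; lra.
Qed.

Lemma CInt_bound (h : R -> C) (a b M : R) :
  a <= b -> continuous_on_itv h a b -> (forall t, a <= t <= b -> Cmod (h t) <= M) ->
  Cmod (CInt h a b) <= (b - a) * M.
Proof.
  intros Hab Hc HM. rewrite Cmod_norm.
  apply (@norm_RInt_le_const C_R_NormedModule h a b); trivial.
  - intros t Ht. specialize (HM t Ht). now rewrite Cmod_norm in HM.
  - now apply CInt_correct.
Qed.

(* The counterclockwise integral of F over the boundary of [x0,x1] x [y0,y1]. *)
Definition rect_int (F : C -> C) (x0 x1 y0 y1 : R) : C :=
  (CInt (fun s => F (s, y0) - F (s, y1)) x0 x1 +
   CInt (fun t => Ci * (F (x1, t) - F (x0, t))) y0 y1)%C.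

Definition continuous_on_rect (F : C -> C) (x0 x1 y0 y1 : R) : Prop :=
  forall a b, x0 <= a <= x1 -> y0 <= b <= y1 -> continuous F (a, b).

Lemma continuous_horizontal (F : C -> C) (s y : R) :
  continuous F (s, y) -> continuous (fun s => F (s, y)) s.
Proof.
  intros H. apply (continuous_comp (fun s => (s, y) : C) F); trivial.
  apply continuous_C_pair; [apply continuous_id | apply continuous_const].
Qed.

Lemma continuous_vertical (F : C -> C) (x t : R) :
  continuous F (x, t) -> continuous (fun t => F (x, t)) t.
Proof.
  intros H. apply (continuous_comp (fun t => (x, t) : C) F); trivial.
  apply continuous_C_pair; [apply continuous_const | apply continuous_id].
Qed.

Lemma continuous_rect_horizontal (F : C -> C) (x0 x1 y0 y1 y y' : R) :
  continuous_on_rect F x0 x1 y0 y1 -> y0 <= y <= y1 -> y0 <= y' <= y1 ->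
  continuous_on_itv (fun s => F (s, y) - F (s, y'))%C x0 x1.
Proof.
  intros Hc Hy Hy' s Hs.
  apply continuous_Cminus; apply continuous_horizontal; now apply Hc.
Qed.

Lemma continuous_rect_vertical (F : C -> C) (x0 x1 y0 y1 x x' : R) :
  continuous_on_rect F x0 x1 y0 y1 -> x0 <= x <= x1 -> x0 <= x' <= x1 ->
  continuous_on_itv (fun t => Ci * (F (x, t) - F (x', t)))%C y0 y1.
Proof.
  intros Hc Hx Hx' t Ht.
  apply continuous_Cmult; [apply continuous_const |].
  apply continuous_Cminus; apply continuous_vertical; now apply Hc.
Qed.

Lemma rect_int_split_x (F : C -> C) (x0 m x1 y0 y1 : R) :
  x0 <= m <= x1 -> y0 <= y1 -> continuous_on_rect F x0 x1 y0 y1 ->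
  rect_int F x0 x1 y0 y1 = (rect_int F x0 m y0 y1 + rect_int F m x1 y0 y1)%C.
Proof.
  intros Hm Hy Hc. unfold rect_int.
  rewrite (CInt_Chasles _ x0 m x1) by
    (trivial; apply (continuous_rect_horizontal F x0 x1 y0 y1); trivial; lra).
  rewrite (CInt_ext (fun t => Ci * (F (x1, t) - F (x0, t)))%C
    (fun t => Ci * (F (m, t) - F (x0, t)) + Ci * (F (x1, t) - F (m, t)))%C) by
    (trivial; intros; ring).
  rewrite CInt_plus by
    (trivial; apply (continuous_rect_vertical F x0 x1 y0 y1); trivial; lra).
  ring.
Qed.

Lemma rect_int_split_y (F : C -> C) (x0 x1 y0 m y1 : R) :
  x0 <= x1 -> y0 <= m <= y1 -> continuous_on_rect F x0 x1 y0 y1 ->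
  rect_int F x0 x1 y0 y1 = (rect_int F x0 x1 y0 m + rect_int F x0 x1 m y1)%C.
Proof.
  intros Hx Hm Hc. unfold rect_int.
  rewrite (CInt_Chasles _ y0 m y1) by
    (trivial; apply (continuous_rect_vertical F x0 x1 y0 y1); trivial; lra).
  rewrite (CInt_ext (fun s => F (s, y0) - F (s, y1))%C
    (fun s => (F (s, y0) - F (s, m)) + (F (s, m) - F (s, y1)))%C) by
    (trivial; intros; ring).
  rewrite CInt_plus by
    (trivial; apply (continuous_rect_horizontal F x0 x1 y0 y1); trivial; lra).
  ring.
Qed.

Lemma rect_int_plus (F G : C -> C) (x0 x1 y0 y1 : R) :
  x0 <= x1 -> y0 <= y1 -> continuous_on_rect F x0 x1 y0 y1 -> continuous_on_rect G x0 x1 y0 y1 ->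
  rect_int (fun z => F z + G z)%C x0 x1 y0 y1 =
  (rect_int F x0 x1 y0 y1 + rect_int G x0 x1 y0 y1)%C.
Proof.
  intros Hx Hy HF HG. unfold rect_int.
  rewrite (CInt_ext (fun s => F (s, y0) + G (s, y0) - (F (s, y1) + G (s, y1)))%C
    (fun s => (F (s, y0) - F (s, y1)) + (G (s, y0) - G (s, y1)))%C) by
    (trivial; intros; ring).
  rewrite (CInt_ext (fun t => Ci * (F (x1, t) + G (x1, t) - (F (x0, t) + G (x0, t))))%C
    (fun t => Ci * (F (x1, t) - F (x0, t)) + Ci * (G (x1, t) - G (x0, t)))%C) by
    (trivial; intros; ring).
  rewrite (CInt_plus (fun s => F (s, y0) - F (s, y1))%C) by
    (trivial; eapply continuous_rect_horizontal; try eassumption; lra).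
  rewrite (CInt_plus (fun t => Ci * (F (x1, t) - F (x0, t)))%C) by
    (trivial; eapply continuous_rect_vertical; try eassumption; lra).
  ring.
Qed.

Lemma rect_int_bound (F : C -> C) (x0 x1 y0 y1 M : R) :
  x0 <= x1 -> y0 <= y1 -> continuous_on_rect F x0 x1 y0 y1 ->
  (forall a b, x0 <= a <= x1 -> y0 <= b <= y1 -> Cmod (F (a, b)) <= M) ->
  Cmod (rect_int F x0 x1 y0 y1) <= 2 * M * ((x1 - x0) + (y1 - y0)).
Proof.
  intros Hx Hy Hc HM. unfold rect_int.
  eapply Rle_trans; [apply Cmod_triangle |].
  assert (H1 : Cmod (CInt (fun s => F (s, y0) - F (s, y1))%C x0 x1) <= (x1 - x0) * (2 * M)).
  { apply CInt_bound; trivial; [eapply continuous_rect_horizontal; try eassumption; lra |].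
    intros s Hs. unfold Cminus. eapply Rle_trans; [apply Cmod_triangle |]. rewrite Cmod_opp.
    assert (G1 := HM s y0 Hs ltac:(lra)). assert (G2 := HM s y1 Hs ltac:(lra)). lra. }
  assert (H2 : Cmod (CInt (fun t => Ci * (F (x1, t) - F (x0, t)))%C y0 y1) <= (y1 - y0) * (2 * M)).
  { apply CInt_bound; trivial; [eapply continuous_rect_vertical; try eassumption; lra |].
    intros t Ht. rewrite Cmod_mult, Cmod_Ci, Rmult_1_l. unfold Cminus.
    eapply Rle_trans; [apply Cmod_triangle |]. rewrite Cmod_opp.
    assert (G1 := HM x1 t ltac:(lra) Ht). assert (G2 := HM x0 t ltac:(lra) Ht). lra. }
  nra.
Qed.

Lemma rect_int_affine (A l c : C) (x0 x1 y0 y1 : R) :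
  x0 <= x1 -> y0 <= y1 -> rect_int (fun z => A + l * (z - c))%C x0 x1 y0 y1 = RtoC 0.
Proof.
  intros Hx Hy. unfold rect_int.
  rewrite (CInt_ext _ (fun _ => l * (- (Ci * RtoC (y1 - y0))))%C) by
    (trivial; intros; apply injective_projections; simpl; ring).
  rewrite (CInt_ext (fun t => Ci * _)%C (fun _ => l * (Ci * RtoC (x1 - x0)))%C) by
    (trivial; intros; apply injective_projections; simpl; ring).
  rewrite !CInt_const. ring.
Qed.

(** The bound [eps * (w + h) ^ 2] reproduces itself exactly under quartering, since four times
    [eps * ((w + h) / 2) ^ 2] is the same quantity. Locally it holds because the affine part of [F]
    integrates to 0 and the remainder is at most [eps / 2 * (w + h)], integrated over a perimeter of
    length [2 * (w + h)]. Then [eps] tends to 0. *)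
Lemma goursat (F : C -> C) (x0 x1 y0 y1 : R) :
  x0 <= x1 -> y0 <= y1 ->
  (forall a b, x0 <= a <= x1 -> y0 <= b <= y1 -> exists l, cdiff F (a, b) l) ->
  rect_int F x0 x1 y0 y1 = RtoC 0.
Proof.
  intros Hx Hy HF.
  assert (Hc : continuous_on_rect F x0 x1 y0 y1).
  { intros a b Ha Hb. destruct (HF a b Ha Hb) as [l Hl]. eapply cdiff_continuous; eauto. }
  assert (Hsub : forall x y w h, x0 <= x -> x + w <= x1 -> y0 <= y -> y + h <= y1 ->
            continuous_on_rect F x (x + w) y (y + h)).
  { intros x y w h H1 H2 H3 H4 a b Ha Hb. apply Hc; lra. }
  set (P eps x y w h := x0 <= x -> x + w <= x1 -> y0 <= y -> y + h <= y1 ->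
     Cmod (rect_int F x (x + w) y (y + h)) <= eps * (w + h) ^ 2).
  assert (HP : forall eps, 0 < eps -> P eps x0 y0 (x1 - x0) (y1 - y0)).
  { intros eps He. apply rectangle_bisection; try lra.
    - intros x y w h Hw Hh P1 P2 P3 P4 H1 H2 H3 H4.
      specialize (P1 ltac:(lra) ltac:(lra) ltac:(lra) ltac:(lra)).
      specialize (P2 ltac:(lra) ltac:(lra) ltac:(lra) ltac:(lra)).
      specialize (P3 ltac:(lra) ltac:(lra) ltac:(lra) ltac:(lra)).
      specialize (P4 ltac:(lra) ltac:(lra) ltac:(lra) ltac:(lra)).
      replace (x + w / 2 + w / 2) with (x + w) in * by field.
      replace (y + h / 2 + h / 2) with (y + h) in * by field.
      rewrite (rect_int_split_x F x (x + w / 2) (x + w)) by (try apply Hsub; lra).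
      rewrite (rect_int_split_y F x (x + w / 2) y (y + h / 2) (y + h)) by (try apply Hsub; lra).
      rewrite (rect_int_split_y F (x + w / 2) (x + w) y (y + h / 2) (y + h)).
      + eapply Rle_trans; [apply Cmod_triangle |].
        eapply Rle_trans; [apply Rplus_le_compat; apply Cmod_triangle |].
        replace (w / 2 + h / 2) with ((w + h) / 2) in * by field.
        replace (eps * (w + h) ^ 2) with (4 * (eps * ((w + h) / 2) ^ 2)) by field. lra.
      + lra.
      + lra.
      + intros a b Ha Hb. apply Hc; lra.
    - intros cx cy Hcx Hcy.
      destruct (HF cx cy ltac:(lra) ltac:(lra)) as [l Hl].
      destruct (proj1 (cdiff_eps _ _ _) Hl (eps / 2) ltac:(lra)) as [d [Hd Hd']].
      exists (d / 2); split; [lra |]. intros x y w h H1 H2 H3 H4 G1 G2 G3 G4.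
      set (c := (cx, cy) : C) in *.
      set (aff := fun z => (F c + l * (z - c))%C).
      set (r := fun z => (F z + (- aff z))%C).
      assert (Caff : forall z, continuous aff z).
      { intros z. apply continuous_Cplus; [apply continuous_const |].
        apply continuous_Cmult; [apply continuous_const |].
        apply continuous_Cminus; [apply continuous_id | apply continuous_const]. }
      assert (Cr : continuous_on_rect r x (x + w) y (y + h)).
      { intros a b Ha Hb. apply continuous_Cplus; [apply Hc; lra | apply continuous_Copp, Caff]. }
      assert (E : rect_int F x (x + w) y (y + h) = rect_int r x (x + w) y (y + h)).
      { transitivity (rect_int (fun z => aff z + r z)%C x (x + w) y (y + h)).
        - unfold rect_int, r; f_equal; apply CInt_ext; try lra; intros; ring.
        - rewrite rect_int_plus; try lra; trivial; [| intros a b _ _; apply Caff].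
          unfold aff at 1. rewrite rect_int_affine by lra. ring. }
      rewrite E.
      eapply Rle_trans; [apply rect_int_bound with (M := eps / 2 * (w + h)); trivial; try lra |].
      + intros a b Ha Hb.
        assert (Hcm : Cmod ((a, b) - c)%C <= w + h).
        { eapply Rle_trans; [apply Cmod_le_abs |]. unfold Re, Im; simpl.
          apply Rplus_le_compat; apply Rabs_le; lra. }
        replace (r (a, b)) with (F (a, b) - F c - l * ((a, b) - c))%C by (unfold r, aff; ring).
        eapply Rle_trans; [apply Hd'; lra |]. apply Rmult_le_compat_l; lra.
      + right; field. }
  apply Cmod_eq_0. apply Rle_antisym; [| apply Cmod_ge_0].
  apply le_epsilon. intros eps He. rewrite Rplus_0_l.
  set (D := (x1 - x0) + (y1 - y0)).
  assert (HD : 0 <= D) by (unfold D; lra).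
  assert (Hq : 0 < eps / (D ^ 2 + 1)) by (apply Rdiv_lt_0_compat; nra).
  specialize (HP _ Hq). unfold P in HP.
  replace (x0 + (x1 - x0)) with x1 in HP by ring. replace (y0 + (y1 - y0)) with y1 in HP by ring.
  specialize (HP ltac:(lra) ltac:(lra) ltac:(lra) ltac:(lra)). fold D in HP.
  eapply Rle_trans; [exact HP |].
  assert (E : eps / (D ^ 2 + 1) * (D ^ 2 + 1) = eps) by (field; nra). nra.
Qed.

(** Cutting out a square of half-side [e] around the exceptional point leaves four rectangles with
    vanishing integral; the square itself contributes at most [8 * M * e], because [F] is bounded
    near the point. This is the form required for a difference quotient, whose differentiability at
    its base point is not yet known. *)
Lemma goursat_removable (F : C -> C) (x0 x1 y0 y1 p q : R) :
  x0 < p < x1 -> y0 < q < y1 -> continuous_on_rect F x0 x1 y0 y1 ->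
  (forall a b, x0 <= a <= x1 -> y0 <= b <= y1 -> (a, b) <> (p, q) -> exists l, cdiff F (a, b) l) ->
  rect_int F x0 x1 y0 y1 = RtoC 0.
Proof.
  intros Hp Hq Hc HF.
  destruct (proj1 (continuous_C_eps _ _) (Hc p q ltac:(lra) ltac:(lra)) 1 Rlt_0_1) as [d [Hd Hd']].
  set (M := Cmod (F (p, q)) + 1).
  assert (HM : 0 < M) by (unfold M; assert (H := Cmod_ge_0 (F (p, q))); lra).
  assert (Hsmall : forall e, 0 < e -> x0 <= p - e -> p + e <= x1 -> y0 <= q - e -> q + e <= y1 ->
     2 * e < d -> Cmod (rect_int F x0 x1 y0 y1) <= 8 * M * e).
  { intros e He H1 H2 H3 H4 Hed.
    rewrite (rect_int_split_x F x0 (p - e) x1) by (trivial; lra).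
    rewrite (goursat F x0 (p - e)); try lra;
      [| intros a b Ha Hb; apply HF; try lra; intros E; injection E; lra].
    rewrite (rect_int_split_x F (p - e) (p + e) x1); try lra;
      [| intros a b Ha Hb; apply Hc; lra].
    rewrite (goursat F (p + e)); try lra;
      [| intros a b Ha Hb; apply HF; try lra; intros E; injection E; lra].
    rewrite (rect_int_split_y F (p - e) (p + e) y0 (q - e) y1); try lra;
      [| intros a b Ha Hb; apply Hc; lra].
    rewrite (goursat F (p - e) (p + e) y0); try lra;
      [| intros a b Ha Hb; apply HF; try lra; intros E; injection E; lra].
    rewrite (rect_int_split_y F (p - e) (p + e) (q - e) (q + e) y1); try lra;
      [| intros a b Ha Hb; apply Hc; lra].
    rewrite (goursat F (p - e) (p + e) (q + e)); try lra;
      [| intros a b Ha Hb; apply HF; try lra; intros E; injection E; lra].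
    replace (0 + (0 + rect_int F (p - e) (p + e) (q - e) (q + e) + 0))%C
      with (rect_int F (p - e) (p + e) (q - e) (q + e)) by ring.
    replace (RtoC 0 + _)%C with (rect_int F (p - e) (p + e) (q - e) (q + e)) by ring.
    eapply Rle_trans; [apply rect_int_bound with (M := M); try lra |].
    - intros a b Ha Hb; apply Hc; lra.
    - intros a b Ha Hb.
      assert (Hab : Cmod ((a, b) - (p, q))%C < d).
      { apply (Rle_lt_trans _ _ _ (Cmod_le_abs _)). unfold Re, Im; simpl.
        assert (Rabs (a + - p) <= e) by (apply Rabs_le; lra).
        assert (Rabs (b + - q) <= e) by (apply Rabs_le; lra). lra. }
      specialize (Hd' _ Hab).
      assert (Ht := Cmod_minus_triangle (F (a, b)) (F (p, q))). unfold M; lra.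
    - right; ring. }
  apply Cmod_eq_0. apply Rle_antisym; [| apply Cmod_ge_0].
  apply le_epsilon. intros eps He. rewrite Rplus_0_l.
  set (e := Rmin (eps / (8 * M)) (Rmin (d / 4) (Rmin (Rmin (p - x0) (x1 - p)) (Rmin (q - y0) (y1 - q))))).
  assert (He0 : 0 < e).
  { unfold e; repeat apply Rmin_glb_lt; try lra. apply Rdiv_lt_0_compat; lra. }
  assert (K1 : e <= eps / (8 * M)) by apply Rmin_l.
  assert (K : e <= Rmin (d / 4) (Rmin (Rmin (p - x0) (x1 - p)) (Rmin (q - y0) (y1 - q)))) by apply Rmin_r.
  assert (K2 := Rle_trans _ _ _ K (Rmin_l _ _)).
  assert (K3 := Rle_trans _ _ _ K (Rmin_r _ _)).
  assert (K4 := Rle_trans _ _ _ K3 (Rmin_l _ _)).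
  assert (K5 := Rle_trans _ _ _ K3 (Rmin_r _ _)).
  assert (K6 := Rle_trans _ _ _ K4 (Rmin_l _ _)).
  assert (K7 := Rle_trans _ _ _ K4 (Rmin_r _ _)).
  assert (K8 := Rle_trans _ _ _ K5 (Rmin_l _ _)).
  assert (K9 := Rle_trans _ _ _ K5 (Rmin_r _ _)).
  eapply Rle_trans; [apply (Hsmall e); lra |].
  apply (Rmult_le_compat_l (8 * M)) in K1; [| lra].
  replace (8 * M * (eps / (8 * M))) with eps in K1 by (field; lra). lra.
Qed.

(** * Derivatives of holomorphic functions are holomorphic *)

Lemma cdiff_quadratic (f : C -> C) (z l : C) (K d : R) :
  0 < d ->
  (forall y, Cmod (y - z) < d -> Cmod (f y - f z - l * (y - z)) <= K * Cmod (y - z) ^ 2) ->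
  cdiff f z l.
Proof.
  intros Hd H. apply cdiff_eps. intros eps He.
  assert (HK := Rabs_pos K). assert (HK' := Rle_abs K).
  assert (Hq : 0 < eps / (Rabs K + 1)) by (apply Rdiv_lt_0_compat; lra).
  exists (Rmin d (eps / (Rabs K + 1))); split; [now apply Rmin_glb_lt |]. intros y Hy.
  assert (H1 := Rlt_le_trans _ _ _ Hy (Rmin_l _ _)).
  assert (H2 := Rlt_le_trans _ _ _ Hy (Rmin_r _ _)).
  eapply Rle_trans; [now apply H |].
  assert (Hc := Cmod_ge_0 (y - z)).
  assert (E : eps / (Rabs K + 1) * (Rabs K + 1) = eps) by (field; lra).
  assert (H3 : K * Cmod (y - z) <= eps) by nra. nra.
Qed.

(** * Differentiation of Cauchy integrals *)

Lemma continuous_on_itv_bounded (h : R -> C) (a b : R) :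
  a <= b -> continuous_on_itv h a b -> exists M, forall t, a <= t <= b -> Cmod (h t) <= M.
Proof.
  intros Hab Hc.
  destruct (continuity_ab_maj (fun t => Cmod (h t)) a b Hab) as [m [Hm _]].
  - intros c Hc'. apply continuity_pt_filterlim. now apply (continuous_Cmod h), Hc.
  - now exists (Cmod (h m)).
Qed.

(** A remainder that is quadratic in [y - z], uniformly in the parameter [t], survives integration;
    this replaces any convergence theorem for integrals. *)
Lemma cdiff_CInt_param (phi : R -> C) (k : C -> R -> C) (k' : R -> C) (a b : R) (z : C) (K d : R) :
  a <= b -> 0 < d -> continuous_on_itv phi a b -> continuous_on_itv k' a b ->
  (forall y, Cmod (y - z) < d -> continuous_on_itv (k y) a b) ->
  (forall y t, Cmod (y - z) < d -> a <= t <= b ->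
     Cmod (k y t - k z t - k' t * (y - z)) <= K * Cmod (y - z) ^ 2) ->
  cdiff (fun y => CInt (fun t => phi t * k y t)%C a b) z (CInt (fun t => phi t * k' t)%C a b).
Proof.
  intros Hab Hd Hphi Hk' Hk H.
  destruct (continuous_on_itv_bounded phi a b Hab Hphi) as [M HM].
  assert (HM0 : 0 <= M) by (eapply Rle_trans; [apply Cmod_ge_0 | apply (HM a); lra]).
  apply (cdiff_quadratic _ _ _ ((b - a) * (M * K)) d Hd). intros y Hy.
  assert (Hz : Cmod (z - z) < d) by (replace (z - z)%C with (RtoC 0) by ring; now rewrite Cmod_0).
  assert (C1 : continuous_on_itv (fun t => phi t * k y t)%C a b)
    by (intros t Ht; apply continuous_Cmult; [now apply Hphi | now apply Hk]).
  assert (C2 : continuous_on_itv (fun t => phi t * k z t)%C a b)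
    by (intros t Ht; apply continuous_Cmult; [now apply Hphi | now apply Hk]).
  assert (C3 : continuous_on_itv (fun t => phi t * k' t)%C a b)
    by (intros t Ht; apply continuous_Cmult; [now apply Hphi | now apply Hk']).
  assert (C4 : continuous_on_itv (fun t => (y - z) * (phi t * k' t))%C a b)
    by (intros t Ht; apply continuous_Cmult; [apply continuous_const | now apply C3]).
  assert (C5 : continuous_on_itv (fun t => phi t * k y t - phi t * k z t)%C a b)
    by (intros t Ht; apply continuous_Cminus; [now apply C1 | now apply C2]).
  rewrite (Cmult_comm _ (y - z)%C).
  rewrite <- CInt_scal by trivial. rewrite <- CInt_minus by trivial.
  rewrite <- CInt_minus by trivial.
  rewrite Rmult_assoc. apply CInt_bound; trivial.
  - intros t Ht. apply continuous_Cminus; [now apply C5 | now apply C4].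
  - intros t Ht.
    replace (phi t * k y t - phi t * k z t - (y - z) * (phi t * k' t))%C
      with (phi t * (k y t - k z t - k' t * (y - z)))%C by ring.
    rewrite Cmod_mult, Rmult_assoc.
    apply Rmult_le_compat; auto; apply Cmod_ge_0.
Qed.

(** A first derivative on a neighbourhood and a second one only at [z]: exactly what the quotient in
    [cdiff_derivative] consumes. *)
Definition twice_cdiff (h : C -> C) (z : C) : Prop :=
  exists h1 d, 0 < d /\ (forall y, Cmod (y - z) < d -> cdiff h y (h1 y)) /\ exists m, cdiff h1 z m.

Lemma twice_cdiff_plus (h g : C -> C) (z : C) :
  twice_cdiff h z -> twice_cdiff g z -> twice_cdiff (fun y => h y + g y)%C z.
Proof.
  intros [h1 [d [Hd [H1 [m Hm]]]]] [g1 [d' [Hd' [G1 [n Hn]]]]].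
  exists (fun y => h1 y + g1 y)%C, (Rmin d d'). split; [now apply Rmin_glb_lt | split].
  - intros y Hy. apply cdiff_plus; [apply H1 | apply G1];
      (eapply Rlt_le_trans; [exact Hy |]); [apply Rmin_l | apply Rmin_r].
  - exists (m + n)%C. now apply cdiff_plus.
Qed.

(** With v = u - h the two remainders are exactly h^2 / (u^2 v) and h^2 (3u - 2h) / (u^3 v^2). The
    constants follow from |v| >= |u| / 2 >= rho / 2 and |3u - 2h| <= 4 |u|. *)
Lemma cauchy_kernel_expansion (u h : C) (rho : R) :
  0 < rho -> rho <= Cmod u -> 2 * Cmod h <= rho ->
  Cmod (/ (u - h) - / u - / (u * u) * h) <= 2 / rho ^ 3 * Cmod h ^ 2 /\
  Cmod (/ ((u - h) * (u - h)) - / (u * u) - 2 / (u * u * u) * h) <= 16 / rho ^ 4 * Cmod h ^ 2.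
Proof.
  intros Hr Hu Hh.
  assert (Hh0 := Cmod_ge_0 h).
  assert (Hv : Cmod u / 2 <= Cmod (u - h)).
  { assert (H := Cmod_minus_triangle u h). lra. }
  assert (Hu0 : u <> RtoC 0) by (apply Cmod_gt_0; lra).
  assert (Hv0 : (u - h)%C <> RtoC 0) by (apply Cmod_gt_0; lra).
  set (v := (u - h)%C) in *.
  assert (Pu : 0 < Cmod u) by lra. assert (Pv : 0 < Cmod v) by lra.
  split.
  - replace (/ v - / u - / (u * u) * h)%C with ((h * h) / (u * u * v))%C
      by (unfold v in *; field; split; trivial).
    rewrite Cmod_div, !Cmod_mult by (repeat apply Cmult_neq_0; trivial).
    unfold Rdiv at 1. rewrite (Rmult_comm (2 / rho ^ 3)).
    replace (Cmod h ^ 2) with (Cmod h * Cmod h) by ring.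
    apply Rmult_le_compat_l; [nra |].
    replace (2 / rho ^ 3) with (/ (rho ^ 3 / 2)) by (field; lra).
    apply Rinv_le_contravar; [assert (0 < rho ^ 3) by (apply pow_lt; lra); lra |].
    replace (rho ^ 3 / 2) with (rho * rho * (rho / 2)) by field.
    apply Rmult_le_compat; nra.
  - replace (/ (v * v) - / (u * u) - 2 / (u * u * u) * h)%C
      with ((h * h) * (3 * u - 2 * h) / (u * u * u * (v * v)))%C
      by (unfold v in *; field; split; trivial).
    rewrite Cmod_div, !Cmod_mult by (repeat apply Cmult_neq_0; trivial).
    assert (Hn : Cmod (3 * u - 2 * h) <= 4 * Cmod u).
    { unfold Cminus. eapply Rle_trans; [apply Cmod_triangle |].
      rewrite Cmod_opp, !Cmod_mult, !Cmod_R, !Rabs_pos_eq by lra. lra. }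
    replace (Cmod h ^ 2) with (Cmod h * Cmod h) by ring.
    unfold Rdiv at 1. rewrite Rmult_assoc, (Rmult_comm (16 / rho ^ 4)).
    apply Rmult_le_compat_l; [nra |].
    apply Rle_trans with (4 * Cmod u * / (Cmod u * Cmod u * Cmod u * (Cmod v * Cmod v))).
    { apply Rmult_le_compat_r; trivial. left; apply Rinv_0_lt_compat.
      repeat apply Rmult_lt_0_compat; trivial. }
    replace (4 * Cmod u * / (Cmod u * Cmod u * Cmod u * (Cmod v * Cmod v)))
      with (/ ((Cmod u * Cmod u) * (Cmod v * Cmod v) / 4)) by (field; lra).
    replace (16 / rho ^ 4) with (/ ((rho * rho) * ((rho / 2) * (rho / 2)) / 4)) by (field; lra).
    apply Rinv_le_contravar.
    + apply Rdiv_lt_0_compat; [| lra]. repeat apply Rmult_lt_0_compat; lra.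
    + apply Rmult_le_compat_r; [lra |]. apply Rmult_le_compat; nra.
Qed.

(** The first derivative is needed on a whole disk, here of radius [rho / 4]. Increments of a
    further [rho / 4] leave the distance to the curve at least [rho / 2], which is why the kernel
    estimates are applied with [rho / 2]. *)
Lemma twice_cdiff_cauchy_integral (phi gam : R -> C) (a b : R) (z : C) (rho : R) :
  a <= b -> 0 < rho -> continuous_on_itv phi a b -> continuous_on_itv gam a b ->
  (forall t, a <= t <= b -> rho <= Cmod (gam t - z)) ->
  twice_cdiff (fun y => CInt (fun t => phi t * / (gam t - y))%C a b) z.
Proof.
  intros Hab Hr Hphi Hg Hfar.
  assert (Hfar2 : forall y t, Cmod (y - z) < rho / 2 -> a <= t <= b -> rho / 2 <= Cmod (gam t - y)).
  { intros y t Hy Ht. specialize (Hfar t Ht).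
    assert (H := Cmod_minus_triangle (gam t - z) (y - z)).
    replace (gam t - z - (y - z))%C with (gam t - y)%C in H by ring. lra. }
  assert (Hne : forall y t, Cmod (y - z) < rho / 2 -> a <= t <= b -> (gam t - y)%C <> RtoC 0).
  { intros y t Hy Ht. apply Cmod_gt_0. specialize (Hfar2 y t Hy Ht). lra. }
  assert (Cg : forall y t, a <= t <= b -> continuous (fun t => gam t - y)%C t).
  { intros y t Ht. apply continuous_Cminus; [now apply Hg | apply continuous_const]. }
  assert (C1 : forall y, Cmod (y - z) < rho / 2 -> continuous_on_itv (fun t => / (gam t - y))%C a b).
  { intros y Hy t Ht. apply continuous_Cinv; [now apply Hne | now apply Cg]. }
  assert (C2 : forall y, Cmod (y - z) < rho / 2 ->
            continuous_on_itv (fun t => / ((gam t - y) * (gam t - y)))%C a b).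
  { intros y Hy t Ht. apply continuous_Cinv; [now apply Cmult_neq_0; apply Hne |].
    now apply continuous_Cmult; apply Cg. }
  assert (C3 : forall y, Cmod (y - z) < rho / 2 ->
            continuous_on_itv (fun t => 2 / ((gam t - y) * (gam t - y) * (gam t - y)))%C a b).
  { intros y Hy t Ht. apply continuous_Cmult; [apply continuous_const |].
    apply continuous_Cinv; [now repeat apply Cmult_neq_0; apply Hne |].
    apply (continuous_Cmult (fun t => (gam t - y) * (gam t - y))%C); [| now apply Cg].
    now apply continuous_Cmult; apply Cg. }
  assert (Hz : Cmod (z - z) < rho / 2)
    by (replace (z - z)%C with (RtoC 0) by ring; rewrite Cmod_0; lra).
  assert (Hsum : forall y y', Cmod (y - z) < rho / 4 -> Cmod (y' - y) < rho / 4 ->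
            Cmod (y' - z) < rho / 2).
  { intros y y' H1 H2. replace (y' - z)%C with ((y' - y) + (y - z))%C by ring.
    eapply Rle_lt_trans; [apply Cmod_triangle |]. lra. }
  exists (fun y => CInt (fun t => phi t * / ((gam t - y) * (gam t - y)))%C a b), (rho / 4).
  split; [lra | split].
  - intros y Hy. assert (Hy2 : Cmod (y - z) < rho / 2) by lra.
    apply (cdiff_CInt_param phi (fun y t => / (gam t - y))%C
             (fun t => / ((gam t - y) * (gam t - y)))%C a b y (2 / (rho / 2) ^ 3) (rho / 4));
      trivial; try lra.
    + now apply C2.
    + intros y' Hy'. apply C1, (Hsum y); trivial.
    + intros y' t Hy' Ht.
      replace (gam t - y')%C with (gam t - y - (y' - y))%C by ring.
      apply cauchy_kernel_expansion; [lra | now apply Hfar2 | lra].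
  - exists (CInt (fun t => phi t * (2 / ((gam t - z) * (gam t - z) * (gam t - z))))%C a b).
    apply (cdiff_CInt_param phi (fun y t => / ((gam t - y) * (gam t - y)))%C
             (fun t => 2 / ((gam t - z) * (gam t - z) * (gam t - z)))%C
             a b z (16 / (rho / 2) ^ 4) (rho / 4)); trivial; try lra.
    + now apply C3.
    + intros y' Hy'. apply C2. lra.
    + intros y' t Hy' Ht.
      replace (gam t - y')%C with (gam t - z - (y' - z))%C by ring.
      apply cauchy_kernel_expansion; [lra | now apply Hfar2 | lra].
Qed.

(* The edges carry the direction factors 1, -1, i, -i of dz. *)
Lemma rect_int_edges (K : C -> C) (x0 x1 y0 y1 : R) :
  x0 <= x1 -> y0 <= y1 -> continuous_on_rect K x0 x1 y0 y1 ->
  rect_int K x0 x1 y0 y1 =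
  (CInt (fun s => RtoC 1 * K (s, y0)) x0 x1 + CInt (fun s => - RtoC 1 * K (s, y1)) x0 x1 +
   (CInt (fun t => Ci * K (x1, t)) y0 y1 + CInt (fun t => - Ci * K (x0, t)) y0 y1))%C.
Proof.
  intros Hx Hy Hc. unfold rect_int.
  assert (H : forall (c : C) y, y0 <= y <= y1 -> continuous_on_itv (fun s => c * K (s, y))%C x0 x1).
  { intros c y Hy' s Hs. apply continuous_Cmult; [apply continuous_const |].
    apply continuous_horizontal. now apply Hc. }
  assert (V : forall (c : C) x, x0 <= x <= x1 -> continuous_on_itv (fun t => c * K (x, t))%C y0 y1).
  { intros c x Hx' t Ht. apply continuous_Cmult; [apply continuous_const |].
    apply continuous_vertical. now apply Hc. }
  rewrite <- (CInt_plus (fun s => RtoC 1 * K (s, y0))%C) by (trivial; apply H; lra).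
  rewrite <- (CInt_plus (fun t => Ci * K (x1, t))%C) by (trivial; apply V; lra).
  f_equal; apply CInt_ext; trivial; intros; ring.
Qed.

Lemma Im_CInt_pos (h : R -> C) (a b : R) :
  a < b -> continuous_on_itv h a b -> (forall t, a <= t <= b -> 0 < Im (h t)) ->
  0 < Im (CInt h a b).
Proof.
  intros Hab Hc Hp.
  assert (Hi := CInt_correct h a b (Rlt_le _ _ Hab) Hc).
  assert (H2 := is_RInt_fct_extend_snd _ _ _ _ Hi).
  assert (E : RInt (fun t => Im (h t)) a b = Im (CInt h a b))
    by exact (is_RInt_unique _ _ _ _ H2).
  rewrite <- E. apply RInt_gt_0; trivial.
  - intros t Ht; apply Hp; lra.
  - intros t Ht. apply continuous_Im, Hc, Ht.
Qed.

(** * Cauchy's formula on a square *)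

Section CauchyOnSquare.

Variables (f g : C -> C) (p q a : R).
Hypothesis Ha : 0 < a.
Hypothesis Hf : forall u v, p - a <= u <= p + a -> q - a <= v <= q + a -> cdiff f (u, v) (g (u, v)).

(** The Cauchy integral of [F] over the boundary of the square, without the factor 1 / (2 pi i). It
    is split into edges so that each summand has the shape treated by
    [twice_cdiff_cauchy_integral]. *)
Definition cauchy_transform (F : C -> C) (y : C) : C :=
  (CInt (fun s => (RtoC 1 * F (s, q - a)%R) * / ((s, q - a)%R - y)) (p - a) (p + a) +
   CInt (fun s => (- RtoC 1 * F (s, q + a)%R) * / ((s, q + a)%R - y)) (p - a) (p + a) +
   (CInt (fun t => (Ci * F ((p + a)%R, t)) * / (((p + a)%R, t) - y)) (q - a) (q + a) +
    CInt (fun t => (- Ci * F ((p - a)%R, t)) * / (((p - a)%R, t) - y)) (q - a) (q + a)))%C.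

Lemma twice_cdiff_cauchy_transform (F : C -> C) :
  continuous_on_rect F (p - a) (p + a) (q - a) (q + a) -> twice_cdiff (cauchy_transform F) (p, q).
Proof.
  intros HF.
  assert (Hh : forall y t, Cmod ((t, y) - (p, q)) >= Rabs (y - q)) by
    (intros; apply Rle_ge, (Im_le_Cmod ((t, y) - (p, q)))).
  assert (Hv : forall x t, Cmod ((x, t) - (p, q)) >= Rabs (x - p)) by
    (intros; apply Rle_ge, (re_le_Cmod ((x, t) - (p, q)))).
  assert (CH : forall (c : C) y, q - a <= y <= q + a ->
     continuous_on_itv (fun s => c * F (s, y))%C (p - a) (p + a)).
  { intros c y Hy s Hs. apply continuous_Cmult; [apply continuous_const |].
    apply continuous_horizontal, HF; trivial. }
  assert (CV : forall (c : C) x, p - a <= x <= p + a ->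
     continuous_on_itv (fun t => c * F (x, t))%C (q - a) (q + a)).
  { intros c x Hx t Ht. apply continuous_Cmult; [apply continuous_const |].
    apply continuous_vertical, HF; trivial. }
  assert (GH : forall y, continuous_on_itv (fun s => (s, y) : C) (p - a) (p + a)).
  { intros y s _. apply continuous_C_pair; [apply continuous_id | apply continuous_const]. }
  assert (GV : forall x, continuous_on_itv (fun t => (x, t) : C) (q - a) (q + a)).
  { intros x t _. apply continuous_C_pair; [apply continuous_const | apply continuous_id]. }
  unfold cauchy_transform. repeat apply twice_cdiff_plus;
    (apply twice_cdiff_cauchy_integral with (rho := a);
      [lra | trivial | first [apply CH | apply CV]; lra | first [apply GH | apply GV] |]);
    intros t _; eapply Rle_trans.
  2: apply Rge_le, Hh. 3: apply Rge_le, Hh. 4: apply Rge_le, Hv. 5: apply Rge_le, Hv.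
  - rewrite <- Rabs_Ropp, Rabs_pos_eq; lra.
  - rewrite Rabs_pos_eq; lra.
  - rewrite Rabs_pos_eq; lra.
  - rewrite <- Rabs_Ropp, Rabs_pos_eq; lra.
Qed.

(* Every edge contributes a positive angle, seen from the centre. *)
Lemma cauchy_transform_1_neq_0 : cauchy_transform (fun _ => RtoC 1) (p, q) <> RtoC 0.
Proof.
  intros E. apply (f_equal Im) in E.
  assert (Hs : forall u, 0 < u * u + a * a) by (intros; nra).
  assert (Hne : forall (u v : R), (u = - a \/ u = a) \/ (v = - a \/ v = a) -> (u, v) <> RtoC 0).
  { intros u v Huv Huv'. injection Huv'; intros; lra. }
  unfold cauchy_transform in E.
  (* [Im] is additive by computation; the anonymous equation distributes it over the four edges. *)
  rewrite !(fun x y : C => eq_refl : Im (x + y) = Im x + Im y) in E.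
  assert (H1 : 0 < Im (CInt (fun s => (RtoC 1 * RtoC 1) * / ((s, q - a)%R - (p, q)))%C (p - a) (p + a))).
  { apply Im_CInt_pos; [lra | |].
    - intros s _. apply continuous_Cmult; [apply continuous_const |]. apply continuous_Cinv.
      + apply (Hne (s + - p) (q - a + - q)). right; left; ring.
      + apply continuous_Cminus; [| apply continuous_const].
        apply continuous_C_pair; [apply continuous_id | apply continuous_const].
    - intros s _. unfold Im; simpl.
      replace (_ + _) with (a / ((s - p) * (s - p) + a * a)); [apply Rdiv_lt_0_compat; trivial |].
      field; repeat split; specialize (Hs (s - p)); nra. }
  assert (H2 : 0 < Im (CInt (fun s => (- RtoC 1 * RtoC 1) * / ((s, q + a)%R - (p, q)))%C (p - a) (p + a))).
  { apply Im_CInt_pos; [lra | |].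
    - intros s _. apply continuous_Cmult; [apply continuous_const |]. apply continuous_Cinv.
      + apply (Hne (s + - p) (q + a + - q)). right; right; ring.
      + apply continuous_Cminus; [| apply continuous_const].
        apply continuous_C_pair; [apply continuous_id | apply continuous_const].
    - intros s _. unfold Im; simpl.
      replace (_ + _) with (a / ((s - p) * (s - p) + a * a)); [apply Rdiv_lt_0_compat; trivial |].
      field; repeat split; specialize (Hs (s - p)); nra. }
  assert (H3 : 0 < Im (CInt (fun t => (Ci * RtoC 1) * / (((p + a)%R, t) - (p, q)))%C (q - a) (q + a))).
  { apply Im_CInt_pos; [lra | |].
    - intros s _. apply continuous_Cmult; [apply continuous_const |]. apply continuous_Cinv.
      + apply (Hne (p + a + - p) (s + - q)). left; right; ring.
      + apply continuous_Cminus; [| apply continuous_const].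
        apply continuous_C_pair; [apply continuous_const | apply continuous_id].
    - intros s _. unfold Im; simpl.
      replace (_ + _) with (a / ((s - q) * (s - q) + a * a)); [apply Rdiv_lt_0_compat; trivial |].
      field; repeat split; specialize (Hs (s - q)); nra. }
  assert (H4 : 0 < Im (CInt (fun t => (- Ci * RtoC 1) * / (((p - a)%R, t) - (p, q)))%C (q - a) (q + a))).
  { apply Im_CInt_pos; [lra | |].
    - intros s _. apply continuous_Cmult; [apply continuous_const |]. apply continuous_Cinv.
      + apply (Hne (p - a + - p) (s + - q)). left; left; ring.
      + apply continuous_Cminus; [| apply continuous_const].
        apply continuous_C_pair; [apply continuous_const | apply continuous_id].
    - intros s _. unfold Im; simpl.
      replace (_ + _) with (a / ((s - q) * (s - q) + a * a)); [apply Rdiv_lt_0_compat; trivial |].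
      field; repeat split; specialize (Hs (s - q)); nra. }
  change (Im (RtoC 0)) with 0 in E. lra.
Qed.

(** The difference quotient [K] of [f] at [y], completed by [g y], is continuous on the square and
    differentiable away from [y], so its boundary integral vanishes. On the edges, which avoid [y],
    the quotient separates into f(z) / (z - y) and f(y) / (z - y). *)
Lemma cauchy_formula_square (u v : R) :
  p - a < u < p + a -> q - a < v < q + a ->
  (f (u, v) * cauchy_transform (fun _ => RtoC 1) (u, v))%C = cauchy_transform f (u, v).
Proof.
  intros Hu Hv. set (y := (u, v) : C).
  set (K := fun z : C => if excluded_middle_informative (z = y) then g y
                     else ((f z - f y) * / (z - y))%C).
  assert (HK : forall z, z <> y -> K z = ((f z - f y) * / (z - y))%C).
  { intros z Hz. unfold K. now destruct (excluded_middle_informative (z = y)). }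
  assert (DK : forall z1 z2, p - a <= z1 <= p + a -> q - a <= z2 <= q + a ->
            (z1, z2) <> y -> exists l, cdiff K (z1, z2) l).
  { intros z1 z2 H1 H2 Hz. assert (Hz' := Cminus_neq_0 _ _ Hz).
    eexists. apply (cdiff_ext_loc (fun z => (f z - f y) * / (z - y))%C _ _ _ (Cmod ((z1, z2) - y))).
    - now apply Cmod_gt_0.
    - intros z Hlt. symmetry. apply HK. intros ->. rewrite Cmod_minus_sym in Hlt. lra.
    - apply cdiff_mult.
      + apply cdiff_minus; [now apply Hf | apply cdiff_const].
      + apply cdiff_inv; trivial. apply cdiff_minus; [apply cdiff_id | apply cdiff_const]. }
  assert (CK : continuous_on_rect K (p - a) (p + a) (q - a) (q + a)).
  { intros z1 z2 H1 H2. destruct (classic ((z1, z2) = y)) as [-> | Hz].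
    (* Near [y] the completed quotient agrees with the slope function of [cdiff], whose continuity
       at [y] is part of the definition. *)
    - destruct (Hf u v ltac:(lra) ltac:(lra)) as [phi [Hc [El [d [Hd H]]]]]. fold y in Hc, El, H.
      apply continuous_C_eps. intros eps He.
      destruct (proj1 (continuous_C_eps _ _) Hc eps He) as [d' [Hd' H']].
      exists (Rmin d d'); split; [now apply Rmin_glb_lt |]. intros z Hz.
      assert (Ky : K y = g y) by (unfold K; now destruct (excluded_middle_informative (y = y))).
      rewrite Ky. destruct (classic (z = y)) as [-> | Hn].
      + rewrite Ky. replace (g y - g y)%C with (RtoC 0) by ring. now rewrite Cmod_0.
      + assert (Hn' := Cminus_neq_0 _ _ Hn). rewrite HK by trivial.
        rewrite (H z) by (eapply Rlt_le_trans; [exact Hz | apply Rmin_l]).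
        replace ((f y + phi z * (z - y) - f y) * / (z - y))%C with (phi z) by (field; trivial).
        rewrite <- El. apply H'. eapply Rlt_le_trans; [exact Hz | apply Rmin_r].
    - destruct (DK z1 z2 H1 H2 Hz) as [l Hl]. eapply cdiff_continuous; eauto. }
  assert (E : rect_int K (p - a) (p + a) (q - a) (q + a) = RtoC 0).
  { now apply (goursat_removable K _ _ _ _ u v). }
  rewrite rect_int_edges in E by (trivial; lra).
  assert (Cf : continuous_on_rect f (p - a) (p + a) (q - a) (q + a)).
  { intros z1 z2 H1 H2. eapply cdiff_continuous; apply Hf; trivial. }
  assert (EH : forall (c : C) s0, q - a <= s0 <= q + a -> s0 <> v ->
    CInt (fun s => c * K (s, s0))%C (p - a) (p + a) =
    (CInt (fun s => (c * f (s, s0)) * / ((s, s0) - y)) (p - a) (p + a) -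
     f y * CInt (fun s => (c * RtoC 1) * / ((s, s0) - y)) (p - a) (p + a))%C).
  { intros c s0 Hs0 Hsv.
    assert (Hn : forall s, (s, s0) <> y) by (intros s E'; injection E'; intros; lra).
    assert (Ck : forall s, continuous (fun s => / ((s, s0) - y))%C s).
    { intros s. apply continuous_Cinv; [apply Cminus_neq_0, Hn |].
      apply continuous_Cminus; [| apply continuous_const].
      apply continuous_C_pair; [apply continuous_id | apply continuous_const]. }
    assert (Ck2 : continuous_on_itv (fun s => (c * RtoC 1) * / ((s, s0) - y))%C (p - a) (p + a))
      by (intros s _; apply continuous_Cmult; [apply continuous_const | apply Ck]).
    rewrite <- CInt_scal by (trivial; lra).
    rewrite <- CInt_minus; [| lra | |].
    - apply CInt_ext; [lra |]. intros s _. rewrite HK by apply Hn. ring.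
    - intros s Hs. apply continuous_Cmult; [| apply Ck].
      apply continuous_Cmult; [apply continuous_const |].
      apply continuous_horizontal. now apply Cf.
    - intros s Hs. apply continuous_Cmult; [apply continuous_const | now apply Ck2]. }
  assert (EV : forall (c : C) s0, p - a <= s0 <= p + a -> s0 <> u ->
    CInt (fun s => c * K (s0, s))%C (q - a) (q + a) =
    (CInt (fun s => (c * f (s0, s)) * / ((s0, s) - y)) (q - a) (q + a) -
     f y * CInt (fun s => (c * RtoC 1) * / ((s0, s) - y)) (q - a) (q + a))%C).
  { intros c s0 Hs0 Hsv.
    assert (Hn : forall s, (s0, s) <> y) by (intros s E'; injection E'; intros; lra).
    assert (Ck : forall s, continuous (fun s => / ((s0, s) - y))%C s).
    { intros s. apply continuous_Cinv; [apply Cminus_neq_0, Hn |].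
      apply continuous_Cminus; [| apply continuous_const].
      apply continuous_C_pair; [apply continuous_const | apply continuous_id]. }
    assert (Ck2 : continuous_on_itv (fun s => (c * RtoC 1) * / ((s0, s) - y))%C (q - a) (q + a))
      by (intros s _; apply continuous_Cmult; [apply continuous_const | apply Ck]).
    rewrite <- CInt_scal by (trivial; lra).
    rewrite <- CInt_minus; [| lra | |].
    - apply CInt_ext; [lra |]. intros s _. rewrite HK by apply Hn. ring.
    - intros s Hs. apply continuous_Cmult; [| apply Ck].
      apply continuous_Cmult; [apply continuous_const |].
      apply continuous_vertical. now apply Cf.
    - intros s Hs. apply continuous_Cmult; [apply continuous_const | now apply Ck2]. }
  rewrite !EH, !EV in E by lra. unfold cauchy_transform.
  rewrite <- (Cplus_0_r (f y * _)%C), <- E. ring.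
Qed.

End CauchyOnSquare.

(** Near [z] the product rule turns f B = A into g = (A1 - f B1) / B, and everything on the right is
    differentiable at [z]. The half-side [r / 3] keeps the square inside the disk of radius [r]. *)
Lemma cdiff_derivative (f g : C -> C) (z : C) (r : R) :
  0 < r -> (forall y, Cmod (y - z) < r -> cdiff f y (g y)) -> exists m, cdiff g z m.
Proof.
  destruct z as [p q]. intros Hr H. set (a := r / 3). assert (Ha : 0 < a) by (unfold a; lra).
  assert (Hf : forall u v, p - a <= u <= p + a -> q - a <= v <= q + a -> cdiff f (u, v) (g (u, v))).
  { intros u v Hu Hv. apply H. apply (Rle_lt_trans _ _ _ (Cmod_le_abs _)). unfold Re, Im; simpl.
    assert (Rabs (u + - p) <= a) by (apply Rabs_le; lra).
    assert (Rabs (v + - q) <= a) by (apply Rabs_le; lra). unfold a in *; lra. }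
  set (A := cauchy_transform p q a f). set (B := cauchy_transform p q a (fun _ => RtoC 1)).
  assert (HAB : forall y, Cmod (y - (p, q)) < a -> (f y * B y)%C = A y).
  { intros [u v] Hy. apply (cauchy_formula_square f g p q a Ha Hf).
    - assert (K := Rle_lt_trans _ _ _ (re_le_Cmod _) Hy). apply Rabs_def2 in K.
      unfold Re in K; simpl in K. lra.
    - assert (K := Rle_lt_trans _ _ _ (Im_le_Cmod _) Hy). apply Rabs_def2 in K.
      unfold Im in K; simpl in K. lra. }
  assert (HB0 : B (p, q) <> RtoC 0) by now apply cauchy_transform_1_neq_0.
  destruct (twice_cdiff_cauchy_transform p q a Ha f) as [A1 [d1 [Hd1 [HA1 [mA HmA]]]]].
  { intros u v Hu Hv. eapply cdiff_continuous; now apply Hf. }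
  destruct (twice_cdiff_cauchy_transform p q a Ha (fun _ => RtoC 1)) as [B1 [d2 [Hd2 [HB1 [mB HmB]]]]].
  { intros u v Hu Hv. apply continuous_const. }
  fold A in HA1. fold B in HB1. set (z := (p, q) : C) in *.
  assert (Hz : Cmod (z - z) = 0) by (replace (z - z)%C with (RtoC 0) by ring; apply Cmod_0).
  assert (DB : cdiff B z (B1 z)) by (apply HB1; lra).
  assert (Df : cdiff f z (g z)) by (apply H; lra).
  destruct (proj1 (continuous_C_eps _ _) (cdiff_continuous _ _ _ DB) (Cmod (B z))) as [d3 [Hd3 HB3]].
  { now apply Cmod_gt_0. }
  set (d := Rmin (Rmin a r) (Rmin (Rmin d1 d2) d3)).
  assert (Hd : 0 < d) by (unfold d; repeat apply Rmin_glb_lt; trivial).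
  assert (Hdd : d <= a /\ d <= r /\ d <= d1 /\ d <= d2 /\ d <= d3).
  { assert (K1 : d <= Rmin a r) by apply Rmin_l.
    assert (K2 : d <= Rmin (Rmin d1 d2) d3) by apply Rmin_r.
    assert (K3 := Rmin_l a r). assert (K4 := Rmin_r a r).
    assert (K5 := Rmin_l (Rmin d1 d2) d3). assert (K6 := Rmin_r (Rmin d1 d2) d3).
    assert (K7 := Rmin_l d1 d2). assert (K8 := Rmin_r d1 d2). lra. }
  eexists. apply (cdiff_ext_loc (fun y => (A1 y - f y * B1 y) * / B y)%C _ _ _ d Hd).
  - intros y Hy.
    assert (HBy : B y <> RtoC 0).
    { intros E. specialize (HB3 y ltac:(lra)). rewrite E in HB3.
      replace (0 - B z)%C with (- B z)%C in HB3 by ring. rewrite Cmod_opp in HB3. lra. }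
    assert (D1 : cdiff (fun y => f y * B y)%C y (g y * B y + f y * B1 y)%C).
    { apply cdiff_mult; [apply H; lra | apply HB1; lra]. }
    assert (D2 : cdiff (fun y => f y * B y)%C y (A1 y)).
    { apply (cdiff_ext_loc A _ _ _ (a - Cmod (y - z))); [lra | | apply HA1; lra].
      intros y' Hy'. symmetry. apply HAB.
      replace (y' - z)%C with ((y' - y) + (y - z))%C by ring.
      eapply Rle_lt_trans; [apply Cmod_triangle |]. lra. }
    rewrite (cdiff_unique _ _ _ _ D2 D1). field. trivial.
  - apply cdiff_mult.
    + apply cdiff_minus; [exact HmA |]. apply cdiff_mult; [exact Df | exact HmB].
    + apply cdiff_inv; trivial. exact DB.
Qed.

(** * The function z f'(z) / f(z) *)

Lemma ex_derive_cdiff (f : C -> C) (z : C) : ex_derive f z <-> exists l, cdiff f z l.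
Proof. split; intros [l Hl]; exists l; now apply is_derive_cdiff. Qed.

Lemma Cderive_cdiff (f : C -> C) (z : C) : ex_derive f z -> cdiff f z (Cderive f z).
Proof. intros H. apply is_derive_cdiff. exact (epsilon_spec _ (fun l => is_derive f z l) H). Qed.

Lemma analytic_Cderive (f : C -> C) (z : C) :
  analytic_on_D f -> inD z -> exists m, cdiff (Cderive f) z m.
Proof.
  intros Hf Hz. apply (cdiff_derivative f (Cderive f) z (1 - Cmod z)); unfold inD in *; [lra |].
  intros y Hy. apply Cderive_cdiff, Hf. unfold inD.
  replace y with ((y - z) + z)%C by ring.
  eapply Rle_lt_trans; [apply Cmod_triangle |]. lra.
Qed.

(** The error has derivative g(w) - g(0) - c w, which is small of first order by the
    differentiability of [g] at 0. The mean value bound along the segment from 0 to [z] is applied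
    to the real and imaginary parts separately, whence the halves of [eps]. *)
Lemma taylor_2 (f g : C -> C) (c : C) (r : R) :
  0 < r -> (forall y, Cmod y < r -> cdiff f y (g y)) -> cdiff g 0 c ->
  forall eps, 0 < eps -> exists d, 0 < d /\ forall z, Cmod z < d ->
    Cmod (f z - f 0 - g 0 * z - c / 2 * (z * z)) <= eps * Cmod z ^ 2.
Proof.
  intros Hr Hf Hc eps He.
  destruct (proj1 (cdiff_eps _ _ _) Hc (eps / 2) ltac:(lra)) as [d [Hd H]].
  exists (Rmin d r); split; [now apply Rmin_glb_lt |]. intros z Hz.
  assert (Hzd := Rlt_le_trans _ _ _ Hz (Rmin_l _ _)).
  assert (Hzr := Rlt_le_trans _ _ _ Hz (Rmin_r _ _)).
  assert (Hz0 := Cmod_ge_0 z).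
  set (e := fun z => (f z - f 0 - g 0 * z - c / 2 * (z * z))%C).
  assert (Hline : forall t, Rabs (t - 0) <= Rabs (1 - 0) -> Cmod (RtoC t * z) <= Cmod z).
  { intros t Ht. rewrite Rminus_0_r, Rminus_0_r, Rabs_R1 in Ht.
    rewrite Cmod_mult, Cmod_R. assert (H0 := Rabs_pos t). nra. }
  assert (De : forall t, Rabs (t - 0) <= Rabs (1 - 0) ->
     cdiff e (0 + RtoC t * z) (g (RtoC t * z) - g 0 - c * (RtoC t * z))%C).
  { intros t Ht. replace (0 + RtoC t * z)%C with (RtoC t * z)%C by ring.
    set (w := (RtoC t * z)%C).
    replace (g w - g 0 - c * w)%C
      with (g w - 0 - g 0 * 1 - (c / 2) * (1 * w + w * 1))%C by (field; now injection).
    unfold e. apply cdiff_minus; [apply cdiff_minus; [apply cdiff_minus |] |].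
    - apply Hf. eapply Rle_lt_trans; [now apply Hline |]. trivial.
    - apply cdiff_const.
    - apply cdiff_scal, cdiff_id.
    - apply cdiff_scal. apply cdiff_mult; apply cdiff_id. }
  assert (Bd : forall t, Rabs (t - 0) <= Rabs (1 - 0) ->
     Cmod ((g (RtoC t * z) - g 0 - c * (RtoC t * z)) * z)%C <= eps / 2 * Cmod z ^ 2).
  { intros t Ht. specialize (Hline t Ht). rewrite Cmod_mult.
    replace (eps / 2 * Cmod z ^ 2) with (eps / 2 * Cmod z * Cmod z) by ring.
    apply Rmult_le_compat_r; trivial.
    specialize (H (RtoC t * z)%C). replace (RtoC t * z - 0)%C with (RtoC t * z)%C in H by ring.
    eapply Rle_trans; [apply H; lra |]. apply Rmult_le_compat_l; lra. }
  assert (HR := bounded_variation (fun t => Re (e (0 + RtoC t * z)%C))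
    (fun t => Re ((g (RtoC t * z) - g 0 - c * (RtoC t * z)) * z)%C) (eps / 2 * Cmod z ^ 2) 0 1).
  assert (HI := bounded_variation (fun t => Im (e (0 + RtoC t * z)%C))
    (fun t => Im ((g (RtoC t * z) - g 0 - c * (RtoC t * z)) * z)%C) (eps / 2 * Cmod z ^ 2) 0 1).
  cbv beta in HR, HI.
  replace (0 + RtoC 1 * z)%C with z in HR, HI by ring.
  replace (0 + RtoC 0 * z)%C with (RtoC 0) in HR, HI by ring.
  assert (E0 : e 0 = RtoC 0) by (unfold e; ring). rewrite E0 in HR, HI.
  change (Re (RtoC 0)) with 0 in HR. change (Im (RtoC 0)) with 0 in HI.
  replace (1 - 0) with 1 in HR, HI by ring.
  rewrite Rminus_0_r, Rabs_R1, Rmult_1_r in HR, HI.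
  fold (e z). eapply Rle_trans; [apply Cmod_le_abs |].
  assert (G1 : Rabs (Re (e z)) <= eps / 2 * Cmod z ^ 2).
  { apply HR. intros t Ht.
    assert (Ht' : Rabs (t - 0) <= Rabs (1 - 0)) by (rewrite (Rminus_0_r 1), Rabs_R1; trivial).
    split; [apply cdiff_line, De, Ht' |].
    eapply Rle_trans; [apply re_le_Cmod | now apply Bd]. }
  assert (G2 : Rabs (Im (e z)) <= eps / 2 * Cmod z ^ 2).
  { apply HI. intros t Ht.
    assert (Ht' : Rabs (t - 0) <= Rabs (1 - 0)) by (rewrite (Rminus_0_r 1), Rabs_R1; trivial).
    split; [apply cdiff_line, De, Ht' |].
    eapply Rle_trans; [apply Im_le_Cmod | now apply Bd]. }
  lra.
Qed.

(** This resolves the 0/0 at the origin: z f' / f becomes f' divided by the completed f(z) / z,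
    whose value at 0 is f'(0). *)
Lemma cdiff_divided_difference (f g : C -> C) (c : C) (r : R) :
  0 < r -> (forall y, Cmod y < r -> cdiff f y (g y)) -> f 0 = RtoC 0 -> cdiff g 0 c ->
  cdiff (fun z => if excluded_middle_informative (z = RtoC 0) then g 0 else (f z / z)%C) 0 (c / 2)%C.
Proof.
  intros Hr Hf Hf0 Hc. apply cdiff_eps. intros eps He.
  destruct (taylor_2 f g c r Hr Hf Hc eps He) as [d [Hd H]].
  exists d; split; trivial. intros z Hz.
  replace (z - 0)%C with z in * by ring.
  destruct (excluded_middle_informative (RtoC 0 = RtoC 0)) as [_ | n]; [| now destruct n].
  destruct (excluded_middle_informative (z = RtoC 0)) as [-> | n].
  - replace (g 0 - g 0 - c / 2 * 0)%C with (RtoC 0) by ring. rewrite Cmod_0. lra.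
  - specialize (H z Hz). rewrite Hf0 in H.
    assert (Hp := proj1 (Cmod_gt_0 z) n).
    replace (f z - 0 - g 0 * z - c / 2 * (z * z))%C
      with ((f z / z - g 0 - c / 2 * z) * z)%C in H
      by (field; trivial).
    rewrite Cmod_mult in H. apply (Rmult_le_reg_r (Cmod z)); trivial. simpl in H. lra.
Qed.

(** Off 0 the quotient rule applies because f' is itself differentiable. At 0 the denominator is
    replaced by the completed f(z) / z, which equals 1 there by the normalisation f'(0) = 1. *)
Lemma zq_analytic_extension (f : C -> C) :
  classA f -> (forall z, inD z -> z <> RtoC 0 -> f z <> RtoC 0) ->
  exists p, analytic_on_D p /\ p (RtoC 0) = RtoC 1 /\
    forall z, inD z -> z <> RtoC 0 -> p z = zq f z.
Proof.
  intros [Han [Hf0 Hf1]] Hne. set (f' := Cderive f).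
  assert (Df : forall y, Cmod y < 1 -> cdiff f y (f' y)) by (intros y Hy; now apply Cderive_cdiff, Han).
  assert (H00 : inD (RtoC 0)) by (unfold inD; rewrite Cmod_0; lra).
  assert (E1 : f' (RtoC 0) = RtoC 1).
  { apply (cdiff_unique f (RtoC 0)); [now apply Df | now apply is_derive_cdiff]. }
  exists (fun z => if excluded_middle_informative (z = RtoC 0) then RtoC 1 else zq f z).
  split; [| split].
  - intros z Hz. apply ex_derive_cdiff.
    destruct (analytic_Cderive f z Han Hz) as [m Hm]. fold f' in Hm.
    destruct (classic (z = RtoC 0)) as [-> | Hz0].
    + assert (Dh := cdiff_divided_difference f f' m 1 Rlt_0_1 Df Hf0 Hm).
      assert (Hh0 : (fun z => if excluded_middle_informative (z = RtoC 0) then f' 0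
                          else (f z / z)%C) (RtoC 0) = RtoC 1).
      { cbv beta. destruct (excluded_middle_informative (RtoC 0 = RtoC 0)) as [_ | n];
          [trivial | now destruct n]. }
      eexists. eapply (cdiff_ext_loc _ _ _ _ 1 Rlt_0_1);
        [| apply cdiff_mult; [exact Hm | apply cdiff_inv; [| exact Dh]]].
      * intros y Hy. replace (y - 0)%C with y in Hy by ring. cbv beta.
        destruct (excluded_middle_informative (y = RtoC 0)) as [-> | n].
        -- rewrite E1. field.
        -- unfold zq. fold f'. assert (Hfy := Hne y Hy n). field; split; trivial.
      * intros E. assert (E' := eq_trans (eq_sym Hh0) E). injection E'; lra.
    + eexists. eapply (cdiff_ext_loc (fun y => (y * f' y) * / f y)%C _ _ _ (Cmod z)).
      * now apply Cmod_gt_0.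
      * intros y Hy. destruct (excluded_middle_informative (y = RtoC 0)) as [-> | n]; [| reflexivity].
        rewrite Cmod_minus_sym in Hy. replace (z - 0)%C with z in Hy by ring. lra.
      * apply cdiff_mult; [apply cdiff_mult; [apply cdiff_id | exact Hm] |].
        apply cdiff_inv; [now apply Hne | now apply Df].
  - now destruct (excluded_middle_informative (RtoC 0 = RtoC 0)) as [_ | n]; [| destruct n].
  - intros z _ Hz. now destruct (excluded_middle_informative (z = RtoC 0)).
Qed.

(** * Minimum principles *)

(** If s < 0, the difference quotients of [psi] based at 0 are below [s / 2] near 0, and the mean
    value theorem makes [phi] fall below [phi 0] on one side. *)
Lemma second_derivative_test (phi psi : R -> R) (s d : R) :
  0 < d -> (forall t, Rabs t < d -> is_derive phi t (psi t)) -> is_derive psi 0 s ->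
  (forall t, Rabs t < d -> phi 0 <= phi t) -> 0 <= s.
Proof.
  intros Hd Hphi Hpsi Hmin. apply Rnot_lt_le; intros Hs.
  apply is_derive_Reals in Hpsi.
  destruct (Hpsi (- s / 2) ltac:(lra)) as [d' Hd'].
  set (e := Rmin d d' / 2).
  assert (He : 0 < e) by (assert (H := Rmin_glb_lt _ _ _ Hd (cond_pos d')); unfold e; lra).
  assert (Hed : e < d) by (assert (H := Rmin_l d d'); unfold e in *; lra).
  assert (Hed' : e < d') by (assert (H := Rmin_r d d'); unfold e in *; lra).
  assert (Hslope : forall c, c <> 0 -> Rabs c <= e -> (psi c - psi 0) / c < s / 2).
  { intros c Hc Hce. specialize (Hd' c Hc ltac:(lra)). rewrite Rplus_0_l in Hd'.
    apply Rabs_def2 in Hd'. lra. }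
  (* Step towards the side on which psi 0 does not oppose the decrease. *)
  destruct (Rle_lt_dec (psi 0) 0) as [H0 | H0].
  - destruct (MVT_cor2 phi psi 0 e He) as [c [Ec Hc]].
    { intros x Hx. apply is_derive_Reals, Hphi. rewrite Rabs_pos_eq; lra. }
    assert (H := Hslope c ltac:(lra) ltac:(rewrite Rabs_pos_eq; lra)).
    apply (Rmult_lt_compat_r c) in H; [| lra].
    replace ((psi c - psi 0) / c * c) with (psi c - psi 0) in H by (field; lra).
    assert (Hm := Hmin e ltac:(rewrite Rabs_pos_eq; lra)).
    assert (s / 2 * c < 0) by nra. assert (psi c * (e - 0) < 0) by nra. lra.
  - destruct (MVT_cor2 phi psi (- e) 0 ltac:(lra)) as [c [Ec Hc]].
    { intros x Hx. apply is_derive_Reals, Hphi. apply Rabs_def1; lra. }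
    assert (H := Hslope c ltac:(lra) ltac:(apply Rabs_le; lra)).
    apply (Rmult_lt_compat_r (- c)) in H; [| lra].
    replace ((psi c - psi 0) / c * - c) with (psi 0 - psi c) in H by (field; lra).
    assert (Hm := Hmin (- e) ltac:(apply Rabs_def1; lra)).
    assert (s / 2 * - c < 0) by nra. assert (0 < psi c * (0 - - e)) by nra. lra.
Qed.

Lemma Cmod_line_sqr (m v : C) (t : R) :
  Cmod v = 1 ->
  Cmod (m + RtoC t * v) ^ 2 = Cmod m ^ 2 + 2 * (Re m * Re v + Im m * Im v) * t + t ^ 2.
Proof.
  intros Hv. assert (H := Cmod2_alt v). rewrite Hv in H.
  rewrite !Cmod2_alt. unfold Re, Im in *; simpl in *. nra.
Qed.

Lemma Cmod_line (m v : C) (t : R) : Cmod v = 1 -> Cmod (m + RtoC t * v - m) = Rabs t.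
Proof.
  intros Hv. replace (m + RtoC t * v - m)%C with (RtoC t * v)%C by ring.
  rewrite Cmod_mult, Hv, Cmod_R. ring.
Qed.

(** The nonnegative quantity is the second derivative at [m], in the unit direction [v], of Re p -
    eta / |z|^2. It is computed from |m + t v|^2 = n + 2 k t + t^2, where n = |m|^2 and k is the
    scalar product of m and v. *)
Lemma Re_minus_barrier_second_order (p p' : C -> C) (m q v : C) (eta r : R) :
  0 < r -> r <= Cmod m -> (forall z, Cmod (z - m) < r -> cdiff p z (p' z)) -> cdiff p' m q ->
  Cmod v = 1 ->
  (forall z, Cmod (z - m) < r -> Re (p m) - eta / Cmod m ^ 2 <= Re (p z) - eta / Cmod z ^ 2) ->
  0 <= Re (q * v * v) + eta * (2 / (Cmod m ^ 2) ^ 2 -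
         8 * (Re m * Re v + Im m * Im v) ^ 2 / (Cmod m ^ 2) ^ 3).
Proof.
  intros Hr Hrm Hp Hq Hv Hmin.
  set (n := Cmod m ^ 2). set (k := Re m * Re v + Im m * Im v).
  assert (Hn : 0 < n) by (apply pow_lt; lra).
  set (N := fun t => n + 2 * k * t + t ^ 2).
  assert (HN : forall t, Cmod (m + RtoC t * v) ^ 2 = N t) by (intros; now apply Cmod_line_sqr).
  assert (HNpos : forall t, Rabs t < r -> 0 < N t).
  { intros t Ht. rewrite <- HN. apply pow_lt.
    assert (H := Cmod_minus_triangle m (- (RtoC t * v))).
    replace (m - - (RtoC t * v))%C with (m + RtoC t * v)%C in H by ring.
    rewrite Cmod_opp, Cmod_mult, Hv, Cmod_R in H. lra. }
  apply (second_derivative_test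
    (fun t => Re (p (m + RtoC t * v)%C) - eta / N t)
    (fun t => Re (p' (m + RtoC t * v) * v)%C - eta * (- (2 * k + 2 * t) / N t ^ 2)) _ r Hr).
  - intros t Ht. apply (is_derive_minus (V := R_NormedModule)).
    + apply cdiff_line, Hp. now rewrite Cmod_line.
    + specialize (HNpos t Ht). unfold N in *. auto_derive; [lra |]. field. lra.
  - replace (Re (q * v * v) + eta * (2 / n ^ 2 - 8 * k ^ 2 / n ^ 3))
      with (Re (q * v * v)%C - eta * (- 2 / n ^ 2 + 8 * k ^ 2 / n ^ 3)) by (field; lra).
    apply (is_derive_minus (V := R_NormedModule)).
    + apply (cdiff_line (fun z => p' z * v)%C).
      replace (m + RtoC 0 * v)%C with m by ring.
      replace (q * v)%C with (q * v + p' m * 0)%C by ring.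
      apply cdiff_mult; [exact Hq | apply cdiff_const].
    + unfold N. auto_derive.
      * assert (H := Rgt_not_eq _ _ (HNpos 0 ltac:(rewrite Rabs_R0; lra))). unfold N in H.
        intros E. apply H. apply Rmult_integral in E. nra.
      * field. lra.
  - intros t Ht. specialize (Hmin (m + RtoC t * v)%C). rewrite Cmod_line in Hmin by trivial.
    specialize (Hmin Ht). rewrite HN in Hmin. fold n in Hmin.
    replace (m + RtoC 0 * v)%C with m by ring.
    replace (N 0) with n by (unfold N; ring). exact Hmin.
Qed.

(* Comparison with the strictly subharmonic barrier eta / |z|^2 on the annulus rho <= |z| <= r. *)
Lemma Re_pos_of_nonneg (p p' : C -> C) :
  (forall z, inD z -> cdiff p z (p' z)) -> 0 < Re (p 0) ->
  (forall z, inD z -> 0 <= Re (p z)) -> forall z, inD z -> 0 < Re (p z).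
Proof.
  unfold inD. intros Hp H0 Hnn z0 Hz0.
  assert (C0 : forall z, Cmod z < 1 -> continuous (fun z => Re (p z)) z).
  { intros z Hz. apply continuous_Re. eapply cdiff_continuous. now apply Hp. }
  destruct (continuous_C_R_eps _ _ (C0 0%C ltac:(rewrite Cmod_0; lra)) (Re (p 0) / 2) ltac:(lra))
    as [d [Hd Hd']].
  assert (Hnear : forall z, Cmod z < d -> Re (p 0) / 2 <= Re (p z)).
  { intros z Hz. specialize (Hd' z). replace (z - 0)%C with z in Hd' by ring.
    specialize (Hd' Hz). apply Rabs_def2 in Hd'. lra. }
  destruct (Rlt_le_dec (Cmod z0) d) as [Hlt | Hge]; [specialize (Hnear z0 Hlt); lra |].
  (* [eta] is chosen so that the barrier equals Re p(0) / 2 on the inner circle, where Re p is at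
     least that large; [z0] lies strictly between the two circles. *)
  set (rho := d / 2). set (r := (1 + Cmod z0) / 2). set (eta := Re (p 0) / 2 * rho ^ 2).
  assert (Hrho : 0 < rho) by (unfold rho; lra).
  assert (Heta : 0 < eta) by (unfold eta; assert (0 < rho ^ 2) by (apply pow_lt; lra); nra).
  assert (Hr : rho < Cmod z0 /\ Cmod z0 < r /\ r < 1) by (unfold rho, r; lra).
  set (G := fun z => Re (p z) - eta / Cmod z ^ 2).
  destruct (continuous_attains_min (fun z => rho <= Cmod z <= r) G r) as [m [Hm Hmin]].
  - exists z0. lra.
  - intros z Hz; lra.
  - intros z Hz.
    assert (Hc : Cmod z < rho \/ r < Cmod z)
      by (destruct (Rlt_le_dec (Cmod z) rho); [left | right]; trivial; lra).
    destruct Hc as [Hc | Hc].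
    + exists (rho - Cmod z); split; [lra |]. intros y Hy.
      assert (H := Cmod_minus_triangle y z). lra.
    + exists (Cmod z - r); split; [lra |]. intros y Hy.
      assert (H := Cmod_minus_triangle z y). rewrite Cmod_minus_sym in H. lra.
  - intros z Hz. apply continuous_Rminus; [apply C0; lra |].
    apply (continuous_Rmult (fun _ => eta)); [apply continuous_const |].
    apply (continuous_comp (fun z => Cmod z ^ 2) Rinv).
    + apply (continuous_Rfct (fun x => x ^ 2)); [apply derivable_continuous, derivable_pow |].
      apply continuous_Cmod, continuous_id.
    + apply continuous_Rinv, Rgt_not_eq, pow_lt. lra.
  - assert (Hsq : forall x y, 0 < x -> x < y -> eta / y ^ 2 < eta / x ^ 2).
    { intros x y Hx Hxy. apply Rmult_lt_compat_l; trivial. apply Rinv_lt_contravar.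
      - apply Rmult_lt_0_compat; apply pow_lt; lra.
      - simpl; nra. }
    (* Once the minimum of [G] is known to lie on a boundary circle, this bound gives Re p(z0) >=
       eta / |z0|^2 - eta / r^2 > 0. *)
    assert (Hlow : - (eta / r ^ 2) <= G m).
    { destruct (Req_dec (Cmod m) rho) as [E | N1]; [| destruct (Req_dec (Cmod m) r) as [E | N2]].
      - unfold G. rewrite E. replace (eta / rho ^ 2) with (Re (p 0) / 2) by (unfold eta; field; lra).
        assert (H1 := Hnear m ltac:(unfold rho in *; lra)).
        assert (0 < eta / r ^ 2) by (apply Rdiv_lt_0_compat; [trivial | apply pow_lt; lra]). lra.
      - unfold G. rewrite E. assert (H1 := Hnn m ltac:(lra)). lra.
      - exfalso.
        set (s := Rmin (Cmod m - rho) (r - Cmod m)).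
        assert (Hs : 0 < s) by (apply Rmin_glb_lt; lra).
        assert (Hs1 : s <= Cmod m - rho) by apply Rmin_l.
        assert (Hs2 : s <= r - Cmod m) by apply Rmin_r.
        assert (Hball : forall z, Cmod (z - m) < s -> rho <= Cmod z <= r).
        { intros z Hz. assert (H1 := Cmod_minus_triangle z m).
          assert (H2 := Cmod_minus_triangle m z). rewrite Cmod_minus_sym in H2. lra. }
        destruct (cdiff_derivative p p' m s Hs) as [q Hq].
        { intros y Hy. apply Hp. specialize (Hball y Hy). lra. }
        assert (T := fun v Hv => Re_minus_barrier_second_order p p' m q v eta s Hs ltac:(lra)
          (fun z Hz => Hp z ltac:(specialize (Hball z Hz); lra)) Hq Hv
          (fun z Hz => Hmin z (Hball z Hz))).
        (* Adding the directions 1 and i cancels Re q, as Re p is harmonic, and leaves 0 <= eta (4 /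
           n^2 - 8 / n^2), which is absurd. *)
        assert (T1 := T (RtoC 1) Cmod_1). assert (T2 := T Ci Cmod_Ci). clear T.
        replace (Re (q * 1 * 1)%C) with (Re q) in T1 by (f_equal; ring).
        replace (Re (q * Ci * Ci)%C) with (- Re q) in T2 by (unfold Re; simpl; ring).
        assert (En := Cmod2_alt m). set (n := Cmod m ^ 2) in *.
        assert (Hn : 0 < n) by (apply pow_lt; lra).
        assert (E : 8 * (Re m * Re 1 + Im m * Im 1) ^ 2 / n ^ 3 +
                    8 * (Re m * Re Ci + Im m * Im Ci) ^ 2 / n ^ 3 = 8 / n ^ 2).
        { transitivity (8 * (Re m ^ 2 + Im m ^ 2) / n ^ 3).
          - unfold Re, Im; simpl. field. lra.
          - rewrite <- En. field. lra. }
        assert (0 < / n ^ 2) by (apply Rinv_0_lt_compat, pow_lt; lra).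
        apply (f_equal (Rmult eta)) in E. unfold Rdiv in *.
        assert (0 < eta * / n ^ 2) by now apply Rmult_lt_0_compat. lra. }
    assert (Hz := Hmin z0 ltac:(lra)). unfold G at 2 in Hz.
    assert (H2 := Hsq (Cmod z0) r ltac:(lra) ltac:(lra)). lra.
Qed.

(** * Functions on the disk without critical points *)

Lemma derivative_neq_0_decreases (phi : R -> R) (l d : R) :
  is_derive phi 0 l -> l <> 0 -> 0 < d -> exists t, Rabs t < d /\ phi t < phi 0.
Proof.
  intros H Hl Hd. apply is_derive_Reals in H.
  destruct (H (Rabs l / 2)) as [d' Hd']; [assert (H' := Rabs_pos_lt l Hl); lra |].
  set (e := Rmin d d' / 2).
  assert (He : 0 < e) by (assert (H' := Rmin_glb_lt _ _ _ Hd (cond_pos d')); unfold e; lra).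
  assert (Hed : e < d) by (assert (H' := Rmin_l d d'); unfold e in *; lra).
  assert (Hed' : e < d') by (assert (H' := Rmin_r d d'); unfold e in *; lra).
  destruct (Rlt_le_dec 0 l) as [Hl' | Hl'].
  - exists (- e). rewrite Rabs_Ropp, Rabs_pos_eq by lra. split; trivial.
    specialize (Hd' (- e) ltac:(lra) ltac:(rewrite Rabs_Ropp, Rabs_pos_eq; lra)).
    rewrite Rplus_0_l, (Rabs_pos_eq l) in Hd' by lra. apply Rabs_def2 in Hd'.
    assert (E : (phi (- e) - phi 0) / - e * e = phi 0 - phi (- e)) by (field; lra). nra.
  - exists e. rewrite Rabs_pos_eq by lra. split; trivial.
    specialize (Hd' e ltac:(lra) ltac:(rewrite Rabs_pos_eq; lra)).
    rewrite Rplus_0_l, (Rabs_left l) in Hd' by lra. apply Rabs_def2 in Hd'.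
    assert (E : (phi e - phi 0) / e * e = phi e - phi 0) by (field; lra). nra.
Qed.

Lemma derivative_neq_0_decreases_in_disk (F : C -> R) (z d : C) (l r : R) :
  is_derive (fun t => F (z + RtoC t * d)%C) 0 l -> l <> 0 -> Cmod z < r ->
  exists y, Cmod y < r /\ F y < F z.
Proof.
  intros H Hl Hz. assert (Hd := Cmod_ge_0 d).
  destruct (derivative_neq_0_decreases _ l ((r - Cmod z) / (Cmod d + 1)) H Hl) as [t [Ht Hlt]].
  - apply Rdiv_lt_0_compat; lra.
  - exists (z + RtoC t * d)%C. split.
    + eapply Rle_lt_trans; [apply Cmod_triangle |]. rewrite Cmod_mult, Cmod_R.
      apply (Rmult_lt_compat_r (Cmod d + 1)) in Ht; [| lra].
      unfold Rdiv in Ht. rewrite Rmult_assoc, Rinv_l in Ht by lra.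
      assert (H0 := Rabs_pos t). nra.
    + now replace (z + RtoC 0 * d)%C with z in Hlt by ring.
Qed.

(** The minimum over the closed disk exists by compactness, and at an interior point a nonzero
    derivative along a single line already allows a further decrease. *)
Lemma no_critical_point_min_on_circle (F : C -> R) :
  (forall z, Cmod z <= 1 -> continuous F z) ->
  (forall z, inD z -> exists d l, l <> 0 /\ is_derive (fun t => F (z + RtoC t * d)%C) 0 l) ->
  forall z, inD z -> exists y, Cmod y = 1 /\ F y < F z.
Proof.
  unfold inD. intros Hc Hd z Hz.
  destruct (continuous_attains_min (fun y => Cmod y <= 1) F 1) as [m [Hm Hmin]]; trivial.
  - exists z. lra.
  - intros y Hy. exists (Cmod y - 1); split; [lra |]. intros x Hx.
    assert (H := Cmod_minus_triangle y x). rewrite Cmod_minus_sym in H. lra.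
  - assert (Hin : forall y, Cmod y < 1 -> F m < F y).
    { intros y Hy. destruct (Hd y Hy) as [v [l [Hl Hv]]].
      destruct (derivative_neq_0_decreases_in_disk F y v l 1 Hv Hl Hy) as [x [Hx Hxy]].
      assert (H := Hmin x ltac:(lra)). lra. }
    exists m; split; [| now apply Hin].
    destruct Hm as [Hm | Hm]; trivial. specialize (Hin m Hm). lra.
Qed.

(** * The function 1 + z exp(z) *)

Lemma Cexp_plus (z w : C) : Cexp (z + w) = (Cexp z * Cexp w)%C.
Proof.
  unfold Cexp, Re, Im; simpl. rewrite exp_plus, cos_plus, sin_plus.
  apply injective_projections; simpl; ring.
Qed.

Lemma Cmod_Cexp (z : C) : Cmod (Cexp z) = exp (Re z).
Proof.
  assert (H := exp_pos (Re z)). assert (T := sin2_cos2 (Im z)). unfold Rsqr in T.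
  unfold Cmod, Cexp; simpl.
  match goal with |- sqrt ?X = _ => replace X with (exp (Re z) ^ 2) by (simpl; nra) end.
  apply sqrt_pow2. lra.
Qed.

Lemma Cexp_neq_0 (z : C) : Cexp z <> RtoC 0.
Proof. apply Cmod_gt_0. rewrite Cmod_Cexp. apply exp_pos. Qed.

Lemma Rabs_sin_le (x : R) : Rabs (sin x) <= Rabs x.
Proof.
  assert (H := bounded_variation sin cos 1 0 x).
  rewrite sin_0, !Rminus_0_r, Rmult_1_l in H. apply H. intros t _.
  split; [apply is_derive_sin |]. apply Rabs_le. assert (B := COS_bound t). lra.
Qed.

Lemma one_minus_cos_bound (x : R) : 0 <= 1 - cos x <= x ^ 2 / 2.
Proof.
  assert (B := COS_bound x). split; [lra |].
  replace x with (2 * (x / 2)) at 1 by field. rewrite cos_2a_sin.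
  assert (H := Rabs_sin_le (x / 2)). apply Rsqr_le_abs_1 in H. unfold Rsqr in H. nra.
Qed.

Lemma sin_minus_id_bound (x : R) : Rabs (sin x - x) <= x ^ 2 / 2 * Rabs x.
Proof.
  assert (H := bounded_variation (fun t => sin t - t) (fun t => cos t - 1) (x ^ 2 / 2) 0 x).
  cbv beta in H. rewrite sin_0, !Rminus_0_r in H. apply H. intros t Ht. split.
  - apply (is_derive_minus (V := R_NormedModule)); [apply is_derive_sin | apply (is_derive_id t)].
  - rewrite Rminus_0_r in Ht. assert (B := one_minus_cos_bound t).
    apply Rsqr_le_abs_1 in Ht. unfold Rsqr in Ht. rewrite Rabs_left1 by lra. nra.
Qed.

(** From exp(-a) >= 1 - a one gets exp a <= 1 / (1 - a), and 1 / (1 - a) - 1 - a = a^2 / (1 - a) <=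
    2 a^2. *)
Lemma exp_expansion (a : R) : Rabs a <= 1 / 2 -> Rabs (exp a - 1 - a) <= 2 * a ^ 2.
Proof.
  intros Ha. apply Rabs_le_between in Ha.
  assert (H1 := exp_ineq1_le a). assert (H2 := exp_ineq1_le (- a)).
  rewrite exp_Ropp in H2.
  rewrite Rabs_pos_eq by lra. assert (Hp := exp_pos a).
  apply (Rmult_le_compat_l (exp a)) in H2; [| lra]. rewrite Rinv_r in H2 by lra. nra.
Qed.

(** For h = a + i b the components are at most 2 a^2 + b^2 and b^2 + 2 |a b|. The constant 10 is
    generous; only the quadratic order matters for the derivative. *)
Lemma Cexp_expansion (h : C) :
  Cmod h < 1 / 2 -> Cmod (Cexp h - 1 - h) <= 10 * Cmod h ^ 2.
Proof.
  intros Hh. assert (E := Cmod2_alt h).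
  assert (Ha := re_le_Cmod h). assert (Hb := Im_le_Cmod h).
  eapply Rle_trans; [apply Cmod_le_abs |]. unfold Re, Im in *; simpl in *.
  set (a := fst h) in *. set (b := snd h) in *.
  assert (He := exp_expansion a ltac:(lra)).
  assert (Hc := one_minus_cos_bound b). assert (Hs := sin_minus_id_bound b).
  assert (Hep := exp_pos a).
  assert (He2 : exp a <= 2).
  { apply Rabs_le_between in He. assert (Ha2 : Rabs a <= 1 / 2) by lra.
    apply Rabs_le_between in Ha2. nra. }
  assert (Hb2 : Rabs b <= 1 / 2) by lra.
  assert (Q1 : Rabs (exp a * cos b + - (1) + - a) <= 2 * a ^ 2 + b ^ 2).
  { replace (exp a * cos b + - (1) + - a) with ((exp a - 1 - a) + (- (exp a * (1 - cos b)))) by ring.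
    eapply Rle_trans; [apply Rabs_triang |]. rewrite Rabs_Ropp, Rabs_mult.
    rewrite (Rabs_pos_eq (exp a)), (Rabs_pos_eq (1 - cos b)) by lra. nra. }
  assert (Q2 : Rabs (exp a * sin b + - 0 + - b) <= b ^ 2 + 2 * (Rabs a * Rabs b)).
  { replace (exp a * sin b + - 0 + - b) with (exp a * (sin b - b) + ((exp a - 1 - a) + a) * b) by ring.
    eapply Rle_trans; [apply Rabs_triang |]. rewrite !Rabs_mult, (Rabs_pos_eq (exp a)) by lra.
    assert (G1 : exp a * Rabs (sin b - b) <= b ^ 2).
    { assert (G := Rabs_pos (sin b - b)). assert (G' := Rabs_pos b).
      apply Rle_trans with (2 * (b ^ 2 / 2 * Rabs b)); [nra |]. nra. }
    assert (G2 : Rabs ((exp a - 1 - a) + a) <= 2 * Rabs a).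
    { eapply Rle_trans; [apply Rabs_triang |].
      assert (2 * a ^ 2 <= Rabs a); [| lra].
      rewrite <- (pow2_abs a). assert (G := Rabs_pos a).
      assert (Ha2 : Rabs a <= 1 / 2) by lra. nra. }
    assert (G' := Rabs_pos b). nra. }
  assert (Q3 : 2 * (Rabs a * Rabs b) <= a ^ 2 + b ^ 2).
  { rewrite <- (pow2_abs a), <- (pow2_abs b). assert (G := pow2_ge_0 (Rabs a - Rabs b)). nra. }
  assert (A0 := pow2_ge_0 a). assert (B0 := pow2_ge_0 b).
  change (Re h) with a. change (Im h) with b. simpl in *. lra.
Qed.

Lemma cdiff_Cexp (z : C) : cdiff Cexp z (Cexp z).
Proof.
  apply (cdiff_quadratic _ _ _ (Cmod (Cexp z) * 10) (1 / 2)); [lra |]. intros y Hy.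
  replace (Cexp y) with (Cexp z * Cexp (y - z))%C by (rewrite <- Cexp_plus; f_equal; ring).
  replace (Cexp z * Cexp (y - z) - Cexp z - Cexp z * (y - z))%C
    with (Cexp z * (Cexp (y - z) - 1 - (y - z)))%C by ring.
  rewrite Cmod_mult, Rmult_assoc. apply Rmult_le_compat_l; [apply Cmod_ge_0 |].
  now apply Cexp_expansion.
Qed.

Lemma cdiff_wp (z : C) : cdiff wp z ((1 + z) * Cexp z)%C.
Proof.
  unfold wp. replace ((1 + z) * Cexp z)%C with (0 + (1 * Cexp z + z * Cexp z))%C by ring.
  apply cdiff_plus; [apply cdiff_const |].
  apply cdiff_mult; [apply cdiff_id | apply cdiff_Cexp].
Qed.

Lemma wp_derivative_neq_0 (z : C) : inD z -> ((1 + z) * Cexp z)%C <> RtoC 0.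
Proof.
  intros Hz. apply Cmult_neq_0; [| apply Cexp_neq_0].
  apply Cmod_gt_0. unfold inD in Hz. assert (H := Cmod_minus_triangle 1 (- z)).
  rewrite Cmod_1, Cmod_opp in H. replace (1 - - z)%C with (1 + z)%C in H by ring. lra.
Qed.

Lemma continuous_wp (z : C) : continuous wp z.
Proof. eapply cdiff_continuous, cdiff_wp. Qed.

(** Dividing [e] by the nonzero derivative of [wp] gives a direction in which the image moves with
    any prescribed velocity [e]. Each extremal argument below only has to choose [e] in the image
    plane. *)
Lemma wp_moves_along (z e : C) : inD z -> exists d,
  is_derive (fun t => Re (wp (z + RtoC t * d)%C)) 0 (Re e) /\
  is_derive (fun t => Im (wp (z + RtoC t * d)%C)) 0 (Im e).
Proof.
  intros Hz. assert (Hn := wp_derivative_neq_0 z Hz).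
  exists (e / ((1 + z) * Cexp z))%C.
  set (d := (e / ((1 + z) * Cexp z))%C).
  assert (E : ((1 + z) * Cexp z * d)%C = e).
  { unfold d. field. split; intros E; apply Hn; rewrite E; ring. }
  assert (H := cdiff_line wp z d ((1 + z) * Cexp z)%C 0).
  rewrite E in H. apply H.
  replace (z + RtoC 0 * d)%C with z by ring. apply cdiff_wp.
Qed.

Lemma unit_circle_angle (z : C) : Cmod z = 1 ->
  exists t, 0 <= t <= PI /\ Re z = cos t /\ (Im z = sin t \/ Im z = - sin t).
Proof.
  intros Hz. assert (E := Cmod2_alt z). rewrite Hz in E.
  assert (B := re_le_Cmod z). rewrite Hz in B. apply Rabs_le_between in B.
  exists (acos (Re z)). split; [apply acos_bound |].
  assert (Ec := cos_acos (Re z) B). split; [now rewrite Ec |].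
  assert (Es := sin2_cos2 (acos (Re z))). rewrite Ec in Es. unfold Rsqr in Es.
  assert (F : (Im z - sin (acos (Re z))) * (Im z + sin (acos (Re z))) = 0) by nra.
  apply Rmult_integral in F. destruct F; [left | right]; lra.
Qed.

(** For z = exp(i t) one has z exp z = exp(cos t) exp(i (t + sin t)). The conjugate point changes
    only the sign of the imaginary part, which the square removes. *)
Lemma wp_on_circle (z : C) (t : R) :
  Re z = cos t -> (Im z = sin t \/ Im z = - sin t) ->
  Re (wp z) = 1 + exp (cos t) * cos (t + sin t) /\
  (Im (wp z)) ^ 2 = (exp (cos t) * sin (t + sin t)) ^ 2.
Proof.
  intros Hr Hi.
  assert (E1 : Re (wp z) = 1 + exp (Re z) * (Re z * cos (Im z) - Im z * sin (Im z)))
    by (unfold wp, Cexp, Re, Im; simpl; ring).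
  assert (E2 : Im (wp z) = exp (Re z) * (Re z * sin (Im z) + Im z * cos (Im z)))
    by (unfold wp, Cexp, Re, Im; simpl; ring).
  rewrite E1, E2, Hr, cos_plus, sin_plus.
  destruct Hi as [-> | ->]; rewrite ?sin_neg, ?cos_neg; split; ring.
Qed.

(* With t = PI/2 - s this is sin x < x <= 1 - s <= exp (-s) for x = cos s - s. *)
Lemma Re_wp_circle_pos (t : R) : 0 <= t <= PI -> 0 < 1 + exp (cos t) * cos (t + sin t).
Proof.
  intros Ht. assert (Hpi := PI_RGT_0). assert (He := exp_pos (cos t)).
  destruct (Rlt_le_dec (PI / 2) t) as [H | H].
  - assert (Hc : cos t < 0) by (apply cos_lt_0; lra).
    assert (He1 : exp (cos t) < 1) by (rewrite <- exp_0; now apply exp_increasing).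
    assert (B := COS_bound (t + sin t)). nra.
  - set (s := PI / 2 - t). set (x := sin t - s).
    assert (Es : t = PI / 2 - s) by (unfold s; ring).
    assert (Est : sin t = cos s) by (rewrite Es; apply sin_shift).
    assert (Ect : cos t = sin s) by (rewrite Es; apply cos_shift).
    replace (t + sin t) with (PI / 2 + x) by (unfold x, s; ring).
    replace (cos (PI / 2 + x)) with (- sin x) by (rewrite sin_cos; ring).
    assert (Hst : 0 <= sin t) by (apply sin_ge_0; lra).
    destruct (Rle_lt_dec x 0) as [Hx | Hx].
    + assert (Hsx : 0 <= sin (- x)) by (apply sin_ge_0; unfold x, s in *; lra).
      rewrite sin_neg in Hsx. nra.
    + assert (Hs0 : 0 <= s) by (unfold s; lra).
      assert (Hxs : x <= 1 - s) by (assert (B := SIN_bound t); unfold x; lra).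
      assert (Hsin : sin x < x) by (now apply sin_lt_x).
      assert (Hc : cos t <= s).
      { rewrite Ect. eapply Rle_trans; [apply Rle_abs |].
        eapply Rle_trans; [apply Rabs_sin_le |]. rewrite Rabs_pos_eq; lra. }
      assert (Hes : exp (cos t) <= exp s).
      { destruct Hc as [Hc | ->]; [left; now apply exp_increasing | lra]. }
      assert (H1 := exp_ineq1_le (- s)). rewrite exp_Ropp in H1.
      assert (Hp := exp_pos s).
      assert (H2 : (1 - s) * exp s <= 1).
      { apply (Rmult_le_compat_r (exp s)) in H1; [| lra]. rewrite Rinv_l in H1 by lra. lra. }
      nra.
Qed.

(** * Location of the image of the disk: half-planes, parabola, sector *)

Lemma Re_wp_gt_min (w0 : R) (z : C) : is_omega0 w0 -> inD z -> w0 < Re (wp z).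
Proof.
  intros [_ H0] Hz.
  destruct (no_critical_point_min_on_circle (fun y => Re (wp y))) with (z := z) as [y [Hy Hlt]]; trivial.
  - intros y _. apply continuous_Re, continuous_wp.
  - intros y Hy. destruct (wp_moves_along y 1 Hy) as [d [Hd _]].
    exists d, 1; split; [lra | exact Hd].
  - specialize (H0 y Hy). lra.
Qed.

Lemma Re_wp_pos (z : C) : inD z -> 0 < Re (wp z).
Proof.
  intros Hz.
  destruct (no_critical_point_min_on_circle (fun y => Re (wp y))) with (z := z) as [y [Hy Hlt]]; trivial.
  - intros y _. apply continuous_Re, continuous_wp.
  - intros y Hy. destruct (wp_moves_along y 1 Hy) as [d [Hd _]].
    exists d, 1; split; [lra | exact Hd].
  - destruct (unit_circle_angle y Hy) as [t [Ht [Er Ei]]].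
    destruct (wp_on_circle y t Er Ei) as [E _]. assert (H := Re_wp_circle_pos t Ht). lra.
Qed.

Lemma Re_wp_lt (z : C) : inD z -> Re (wp z) < 1 + exp 1.
Proof.
  unfold inD; intros Hz.
  assert (E : Re (wp z) = 1 + Re (z * Cexp z)%C) by (unfold wp, Re; simpl; ring).
  assert (H := re_le_Cmod (z * Cexp z)). rewrite Cmod_mult, Cmod_Cexp in H.
  assert (H2 := re_le_Cmod z). apply Rabs_le_between in H. apply Rabs_le_between in H2.
  assert (He : exp (Re z) < exp 1) by (apply exp_increasing; lra).
  assert (Hp := exp_pos (Re z)). nra.
Qed.

(** The value at PI / 2 is cos(1)^2 / (4 (1 - sin 1)) > 0. Positivity makes every a >= b a genuine
    focal parameter. *)
Lemma bmax_pos (b : R) : is_bmax b -> 0 < b.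
Proof.
  intros [_ H]. assert (Hpi := PI_RGT_0). assert (Hpi2 := PI2_1).
  eapply Rlt_le_trans; [| apply (H (PI / 2)); lra].
  assert (Hp := Re_wp_circle_pos (PI / 2) ltac:(lra)).
  unfold Tfun. rewrite sin_PI2 in *.
  apply Rdiv_lt_0_compat; [| lra]. apply Rmult_lt_0_compat; [apply exp_pos |].
  rewrite <- cos_sin. assert (Hc : 0 < cos 1) by (apply cos_gt_0; lra). now apply pow_lt.
Qed.

Lemma wp_parabola (a b : R) (z : C) :
  is_bmax b -> b <= a -> inD z -> (Im (wp z)) ^ 2 < 4 * a * Re (wp z).
Proof.
  intros Hb Hab Hz. assert (Hb0 := bmax_pos b Hb). destruct Hb as [_ Hb].
  destruct (no_critical_point_min_on_circle (fun y => 4 * a * Re (wp y) - Im (wp y) * Im (wp y)))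
    with (z := z) as [y [Hy Hlt]]; trivial.
  - intros y _. assert (C1 := continuous_Re wp y (continuous_wp y)).
    assert (C2 := continuous_Im wp y (continuous_wp y)).
    apply continuous_Rminus; apply continuous_Rmult; trivial. apply continuous_const.
  (* Moving the image horizontally leaves its imaginary part stationary, so the derivative is 4 a,
     which is nonzero. *)
  - intros y Hy. destruct (wp_moves_along y 1 Hy) as [d [Hr Hi]].
    exists d, (4 * a * 1 - (0 * Im (wp (y + RtoC 0 * d)%C) + Im (wp (y + RtoC 0 * d)%C) * 0)).
    split; [lra |].
    apply (is_derive_minus (V := R_NormedModule)).
    + apply is_derive_scal. exact Hr.
    + apply Derive.is_derive_mult; exact Hi.
  - destruct (unit_circle_angle y Hy) as [t [Ht [Er Ei]]].
    destruct (wp_on_circle y t Er Ei) as [E1 E2].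
    assert (Hp := Re_wp_circle_pos t Ht). specialize (Hb t Ht). unfold Tfun in Hb.
    replace (exp (2 * cos t)) with (exp (cos t) ^ 2) in Hb
      by (simpl; rewrite Rmult_1_r, <- exp_plus; f_equal; ring).
    rewrite <- Rpow_mult_distr, <- E2, <- E1 in Hb. rewrite <- E1 in Hp.
    apply (Rmult_le_compat_r (4 * Re (wp y))) in Hb; [| lra].
    unfold Rdiv in Hb. rewrite Rmult_assoc, Rinv_l in Hb by lra.
    assert (b * (4 * Re (wp y)) <= a * (4 * Re (wp y))) by (apply Rmult_le_compat_r; lra). nra.
Qed.

(** Focus a and directrix Re = -a: the difference |w - a|^2 - (Re w + a)^2 equals (Im w)^2 - 4 a Re
    w. *)
Lemma parabola_focal (a : R) (w : C) :
  0 < a -> (Im w) ^ 2 < 4 * a * Re w -> Cmod (w - RtoC a) < Re w + a.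
Proof.
  intros Ha H. assert (Hw : 0 < Re w) by (assert (H2 := pow2_ge_0 (Im w)); nra).
  assert (E := Cmod2_alt (w - RtoC a)). assert (Hp := Cmod_ge_0 (w - RtoC a)).
  unfold Re, Im in *; simpl in *. nra.
Qed.

Lemma Carg_Re_pos (w : C) : 0 < Re w -> Carg w = atan (Im w / Re w).
Proof. intros H. unfold Carg. now destruct (Rlt_dec 0 (Re w)). Qed.

Lemma atan_increasing_le (x y : R) : x <= y -> atan x <= atan y.
Proof. intros [H | ->]; [left; now apply atan_increasing | lra]. Qed.

(** In the right half-plane the argument is monotone in the slope Im / Re, and the image of a point
    can be pushed across its own ray to either side. *)
Lemma Carg_wp_not_max (z : C) :
  inD z -> exists y, inD y /\ Rabs (Carg (wp z)) < Rabs (Carg (wp y)).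
Proof.
  intros Hz. assert (Hu := Re_wp_pos z Hz). set (m := Im (wp z) / Re (wp z)).
  assert (Hm : Im (wp z) = m * Re (wp z)) by (unfold m; field; lra).
  assert (Hmove : forall s, s = 1 \/ s = -1 ->
            exists y, inD y /\ s * (m * Re (wp y) - Im (wp y)) < 0).
  { intros s Hs. destruct (wp_moves_along z (m, -1) Hz) as [d [Hr Hi]].
    destruct (derivative_neq_0_decreases_in_disk
      (fun y => s * (m * Re (wp y) - Im (wp y))) z d (s * (m * m - -1)) 1) as [y [Hy Hlt]]; trivial.
    - apply is_derive_scal. apply (is_derive_minus (V := R_NormedModule)); [| exact Hi].
      apply is_derive_scal. exact Hr.
    - destruct Hs as [-> | ->]; nra.
    - exists y; split; trivial. rewrite Hm in Hlt. nra. }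
  rewrite Carg_Re_pos by trivial. fold m.
  destruct (Rle_lt_dec 0 m) as [H | H].
  - destruct (Hmove 1 (or_introl eq_refl)) as [y [Hy Hlt]]. exists y; split; trivial.
    assert (Hy' := Re_wp_pos y Hy). rewrite Carg_Re_pos by trivial.
    assert (Hmy : m < Im (wp y) / Re (wp y)).
    { apply (Rmult_lt_reg_r (Re (wp y))); trivial. unfold Rdiv. rewrite Rmult_assoc, Rinv_l; lra. }
    assert (Ha := atan_increasing _ _ Hmy). assert (Ha0 := atan_increasing_le _ _ H).
    rewrite atan_0 in Ha0. rewrite !Rabs_pos_eq; lra.
  - destruct (Hmove (-1) (or_intror eq_refl)) as [y [Hy Hlt]]. exists y; split; trivial.
    assert (Hy' := Re_wp_pos y Hy). rewrite Carg_Re_pos by trivial.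
    assert (Hmy : Im (wp y) / Re (wp y) < m).
    { apply (Rmult_lt_reg_r (Re (wp y))); trivial. unfold Rdiv. rewrite Rmult_assoc, Rinv_l; lra. }
    assert (Ha := atan_increasing _ _ Hmy). assert (Ha0 := atan_increasing _ _ H).
    rewrite atan_0 in Ha0. rewrite !Rabs_left; lra.
Qed.

Lemma Carg_right_half_plane (w : C) : Rabs (Carg w) < PI / 2 -> 0 <= Re w.
Proof.
  intros H. apply Rnot_lt_le; intros Hw. revert H. unfold Carg.
  destruct (Rlt_dec 0 (Re w)); [lra |]. destruct (Rlt_dec (Re w) 0); [| lra].
  assert (B := atan_bound (Im w / Re w)). intros H. apply Rabs_def2 in H.
  destruct (Rle_dec 0 (Im w)); lra.
Qed.

(** * Inverting 1 + z exp(z) on conic domains *)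

Lemma exp_1_gt : 5 / 2 < exp 1.
Proof.
  assert (H := exp_ineq1_le (1 / 8)).
  assert (H2 : exp (1 / 4) = exp (1 / 8) * exp (1 / 8)) by (rewrite <- exp_plus; f_equal; field).
  assert (H3 : exp (1 / 2) = exp (1 / 4) * exp (1 / 4)) by (rewrite <- exp_plus; f_equal; field).
  assert (H4 : exp 1 = exp (1 / 2) * exp (1 / 2)) by (rewrite <- exp_plus; f_equal; field).
  (* Repeated squaring of exp(1/8) >= 9/8, rounded down at each stage. *)
  assert (1.265 <= exp (1 / 4)) by nra. assert (1.6 <= exp (1 / 2)) by nra. nra.
Qed.

(** For x >= 0 the gap is at least (1 - x)(exp x - 1), because exp(1 - x) >= 2 - x. For x < 0, exp x
    <= 1 / (1 - x) bounds the left side by 3/2, which is below e - 1 since e > 5/2. *)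
Lemma exp_minus_id_le (x : R) : -1 <= x <= 1 -> exp x - x <= exp 1 - 1.
Proof.
  intros Hx. assert (Hp := exp_pos x). assert (He := exp_1_gt).
  destruct (Rle_lt_dec 0 x) as [H | H].
  - assert (E : exp 1 = exp x * exp (1 - x)) by (rewrite <- exp_plus; f_equal; ring).
    assert (H1 := exp_ineq1_le x). assert (H2 := exp_ineq1_le (1 - x)). nra.
  - assert (H1 := exp_ineq1_le (- x)).
    assert (E : exp x * exp (- x) = 1) by (rewrite <- exp_plus, <- exp_0; f_equal; ring).
    assert (H2 : exp x * (1 - x) <= 1) by nra. nra.
Qed.

(** On the circle |wp - 1| = exp(cos t), and cos(t + sin t) <= cos t because t <= t + sin t <= PI.
    After division by exp(cos t) there remains exp x - x <= k with x = - cos t. *)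
Lemma wp_circle_outside_conic (k : R) (z : C) :
  exp 1 - 1 <= k -> Cmod z = 1 -> Re (wp z) <= k * Cmod (wp z - 1).
Proof.
  intros Hk Hz. destruct (unit_circle_angle z Hz) as [t [Ht [Er Ei]]].
  destruct (wp_on_circle z t Er Ei) as [E _].
  replace (wp z - 1)%C with (z * Cexp z)%C by (unfold wp; ring).
  rewrite Cmod_mult, Cmod_Cexp, Hz, E, Er.
  assert (Hs : 0 <= sin t) by (apply sin_ge_0; lra).
  assert (Hs2 : sin t <= PI - t).
  { rewrite <- sin_PI_x. eapply Rle_trans; [apply Rle_abs |].
    eapply Rle_trans; [apply Rabs_sin_le |]. rewrite Rabs_pos_eq; lra. }
  assert (Hc : cos (t + sin t) <= cos t) by (apply cos_decr_1; lra).
  assert (B := COS_bound t).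
  assert (H := exp_minus_id_le (- cos t) ltac:(lra)).
  assert (Hp := exp_pos (cos t)).
  assert (E1 : exp (cos t) * exp (- cos t) = 1)
    by (rewrite <- exp_plus, <- exp_0; f_equal; ring).
  assert (exp (cos t) * exp (- cos t) <= exp (cos t) * (exp 1 - 1 - cos t))
    by (apply Rmult_le_compat_l; lra).
  assert (exp (cos t) * cos (t + sin t) <= exp (cos t) * cos t)
    by (apply Rmult_le_compat_l; lra).
  assert (exp (cos t) * (exp 1 - 1) <= exp (cos t) * k) by (apply Rmult_le_compat_l; lra).
  lra.
Qed.

Definition conic_defect (k : R) (w : C) : R := k * Cmod (w - 1) - Re w.

Lemma continuous_conic_defect (k : R) (w : C) : continuous (conic_defect k) w.
Proof.
  apply continuous_Rminus.
  - apply (continuous_Rmult (fun _ => k)); [apply continuous_const |].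
    apply (continuous_Cmod (fun w => w - 1)%C).
    apply continuous_Cminus; [apply continuous_id | apply continuous_const].
  - apply (continuous_Re (fun w => w)), continuous_id.
Qed.

Lemma conic_defect_wp_0 (k : R) : conic_defect k (wp 0) = -1.
Proof.
  unfold conic_defect. replace (wp 0) with (RtoC 1) by (unfold wp; ring).
  replace (1 - 1)%C with (RtoC 0) by ring. rewrite Cmod_0. unfold Re; simpl. ring.
Qed.

(** Convexity together with the Lipschitz constant k + 1, which absorbs the linearisation error [r]
    of a step towards the target. *)
Lemma conic_defect_convex (k t : R) (u v r : C) :
  0 <= k -> 0 <= t <= 1 ->
  conic_defect k (RtoC (1 - t) * u + RtoC t * v + r) <=
  (1 - t) * conic_defect k u + t * conic_defect k v + (k + 1) * Cmod r.
Proof.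
  intros Hk Ht. unfold conic_defect.
  assert (H : Cmod (RtoC (1 - t) * u + RtoC t * v + r - 1) <=
              (1 - t) * Cmod (u - 1) + t * Cmod (v - 1) + Cmod r).
  { replace (RtoC (1 - t) * u + RtoC t * v + r - 1)%C
      with (RtoC (1 - t) * (u - 1) + RtoC t * (v - 1) + r)%C by (rewrite RtoC_minus; ring).
    eapply Rle_trans; [apply Cmod_triangle |]. apply Rplus_le_compat_r.
    eapply Rle_trans; [apply Cmod_triangle |].
    rewrite !Cmod_mult, !Cmod_R, !Rabs_pos_eq by lra. lra. }
  assert (E : Re (RtoC (1 - t) * u + RtoC t * v + r)%C = (1 - t) * Re u + t * Re v + Re r)
    by (unfold Re; simpl; ring).
  rewrite E. assert (B := re_le_Cmod r). apply Rabs_le_between in B.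
  apply (Rmult_le_compat_l k) in H; trivial. lra.
Qed.

Lemma conic_sublevel_closed (k c : R) (z : C) :
  ~ (Cmod z <= 1 /\ conic_defect k (wp z) <= c) ->
  exists d, 0 < d /\ forall y, Cmod (y - z) < d -> ~ (Cmod y <= 1 /\ conic_defect k (wp y) <= c).
Proof.
  intros Hn. destruct (Rlt_le_dec 1 (Cmod z)) as [H | H].
  - exists (Cmod z - 1); split; [lra |]. intros x Hx [Hx1 _].
    assert (T := Cmod_minus_triangle z x). rewrite Cmod_minus_sym in T. lra.
  - assert (H' : c < conic_defect k (wp z)) by (apply Rnot_le_lt; intros H'; now apply Hn).
    destruct (continuous_C_R_eps (fun z => conic_defect k (wp z)) z) with
      (eps := conic_defect k (wp z) - c) as [d [Hd Hd']]; [| lra |].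
    + apply (continuous_comp wp); [apply continuous_wp | apply continuous_conic_defect].
    + exists d; split; trivial. intros y Hy [_ Hy'].
      specialize (Hd' y Hy). apply Rabs_def2 in Hd'. lra.
Qed.

(** The largest modulus on this compact sublevel set is attained, and it is not 1 because the defect
    is nonnegative on the circle. The radius [rho] supplies a uniform constant in [wp_expansive]. *)
Lemma conic_sublevel_in_smaller_disk (k c : R) :
  exp 1 - 1 <= k -> c < 0 ->
  exists rho, rho < 1 /\ forall z, Cmod z <= 1 -> conic_defect k (wp z) <= c -> Cmod z <= rho.
Proof.
  intros Hk Hc.
  destruct (classic (exists z, Cmod z <= 1 /\ conic_defect k (wp z) <= c)) as [Hne | Hne].
  - destruct (continuous_attains_min (fun z => Cmod z <= 1 /\ conic_defect k (wp z) <= c)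
      (fun z => - Cmod z) 1) as [m [[Hm1 Hm2] Hm]]; trivial.
    + now intros z [Hz _].
    + apply conic_sublevel_closed.
    + intros z _. apply continuous_Ropp, (continuous_Cmod (fun z => z)), continuous_id.
    + exists (Cmod m). split.
      * destruct Hm1 as [Hm1 | Hm1]; trivial.
        assert (H := wp_circle_outside_conic k m Hk Hm1). unfold conic_defect in Hm2. lra.
      * intros z Hz1 Hz2. specialize (Hm z (conj Hz1 Hz2)). lra.
  - exists 0. split; [lra |]. intros z Hz1 Hz2. exfalso; apply Hne; now exists z.
Qed.

(* A point of the closed disk whose image is closest to w, among those mapped well inside the
   conic domain, is mapped to w: otherwise a step towards w stays inside by convexity. *)
Lemma wp_onto_conic (k : R) (w : C) :
  exp 1 - 1 <= k -> k * Cmod (w - 1) < Re w -> exists z, inD z /\ wp z = w.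
Proof.
  intros Hk Hw. assert (He := exp_1_gt). set (d := - conic_defect k w).
  assert (Hd : 0 < d) by (unfold d, conic_defect; lra).
  (* Since k >= 1 and Re w <= 1 + |w - 1|, the defect is never below -1, its value at [wp 0]. Hence
     0 is a competitor in the minimisation. *)
  assert (Hd1 : d <= 1).
  { unfold d, conic_defect. assert (H := re_le_Cmod (w - 1)).
    apply Rabs_le_between in H. unfold Re in *; simpl in *.
    assert (H0 := Cmod_ge_0 (w - 1)). nra. }
  destruct (continuous_attains_min (fun z => Cmod z <= 1 /\ conic_defect k (wp z) <= - d / 2)
      (fun z => Cmod (wp z - w)) 1) as [m [[Hm1 Hm2] Hmin]].
  - exists 0%C. rewrite Cmod_0, conic_defect_wp_0. lra.
  - now intros z [Hz _].
  - apply conic_sublevel_closed.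
  - intros z _. apply continuous_Cmod.
    apply continuous_Cminus; [apply continuous_wp | apply continuous_const].
  - assert (Hm : Cmod m < 1).
    { destruct Hm1 as [Hm1 | Hm1]; trivial.
      assert (H := wp_circle_outside_conic k m Hk Hm1). unfold conic_defect in Hm2. lra. }
    exists m; split; [exact Hm |]. apply NNPP; intros Hne.
    assert (Hn := wp_derivative_neq_0 m Hm).
    set (l := ((1 + m) * Cexp m)%C) in *. set (e := (w - wp m)%C).
    assert (He0 : 0 < Cmod e).
    { apply Cmod_gt_0, Cminus_neq_0. intros E; now apply Hne. }
    (* The Newton direction: to first order, a step t v moves the image by the fraction t of the way
       to [w]. *)
    set (v := (e / l)%C). assert (Elv : (l * v)%C = e) by (unfold v; field; trivial).
    assert (Hv0 := Cmod_ge_0 v).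
    (* With an error of at most kap t, the first bound makes the distance to [w] drop by at least t
       |e| / 2, and the second keeps the defect at most -d / 2. *)
    set (kap := Rmin (Cmod e / 2) (d / (2 * (k + 1)))).
    assert (Hkap : 0 < kap) by (apply Rmin_glb_lt; [lra | apply Rdiv_lt_0_compat; lra]).
    assert (Hkap1 : kap <= Cmod e / 2) by apply Rmin_l.
    assert (Hkap2 : (k + 1) * kap <= d / 2).
    { replace (d / 2) with ((k + 1) * (d / (2 * (k + 1)))) by (field; lra).
      apply Rmult_le_compat_l; [lra | apply Rmin_r]. }
    destruct (proj1 (cdiff_eps _ _ _) (cdiff_wp m) (kap / (Cmod v + 1))) as [del [Hdel Hdel']].
    { apply Rdiv_lt_0_compat; lra. }
    fold l in Hdel'.
    (* The three bounds make the combination convex, keep the step within reach of the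
       linearisation, and keep the new point in the closed disk. *)
    set (t := Rmin (1 / 2) (Rmin (del / (2 * (Cmod v + 1))) ((1 - Cmod m) / (Cmod v + 1)))).
    assert (Ht0 : 0 < t) by (repeat apply Rmin_glb_lt; try apply Rdiv_lt_0_compat; lra).
    assert (Ht1 : t <= 1 / 2) by apply Rmin_l.
    assert (Ht2 : t <= Rmin (del / (2 * (Cmod v + 1))) ((1 - Cmod m) / (Cmod v + 1))) by apply Rmin_r.
    assert (Ht3 := Rle_trans _ _ _ Ht2 (Rmin_l _ _)).
    assert (Ht4 := Rle_trans _ _ _ Ht2 (Rmin_r _ _)).
    assert (Ht3' : t * (Cmod v + 1) <= del / 2).
    { replace (del / 2) with (del / (2 * (Cmod v + 1)) * (Cmod v + 1)) by (field; lra).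
      apply Rmult_le_compat_r; lra. }
    assert (Ht4' : t * (Cmod v + 1) <= 1 - Cmod m).
    { replace (1 - Cmod m) with ((1 - Cmod m) / (Cmod v + 1) * (Cmod v + 1)) by (field; lra).
      apply Rmult_le_compat_r; lra. }
    set (y := (m + RtoC t * v)%C).
    assert (Eym : (y - m)%C = (RtoC t * v)%C) by (unfold y; ring).
    assert (Cym : Cmod (y - m) = t * Cmod v) by (rewrite Eym, Cmod_mult, Cmod_R, Rabs_pos_eq; lra).
    assert (Hr := Hdel' y ltac:(rewrite Cym; nra)).
    set (r := (wp y - wp m - l * (y - m))%C) in *.
    assert (Hr' : Cmod r <= kap * t).
    { eapply Rle_trans; [exact Hr |]. rewrite Cym.
      replace (kap / (Cmod v + 1) * (t * Cmod v)) with (kap * t * (Cmod v / (Cmod v + 1))) by (field; lra).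
      rewrite <- (Rmult_1_r (kap * t)) at 2. apply Rmult_le_compat_l; [nra |].
      apply (Rmult_le_reg_r (Cmod v + 1)); [lra |]. unfold Rdiv. rewrite Rmult_assoc, Rinv_l; lra. }
    assert (Ewy : wp y = (RtoC (1 - t) * wp m + RtoC t * w + r)%C).
    { unfold r. rewrite Eym. replace (l * (RtoC t * v))%C with (RtoC t * (l * v))%C by ring.
      rewrite Elv. unfold e. rewrite RtoC_minus. ring. }
    assert (Hy : Cmod (wp m - w) <= Cmod (wp y - w)).
    { apply Hmin. split.
      - unfold y. eapply Rle_trans; [apply Cmod_triangle |].
        rewrite Cmod_mult, Cmod_R, Rabs_pos_eq; nra.
      - rewrite Ewy. eapply Rle_trans; [apply conic_defect_convex; lra |].
        assert (Ed : conic_defect k w = - d) by (unfold d; ring). rewrite Ed.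
        assert ((k + 1) * Cmod r <= (k + 1) * (kap * t)) by (apply Rmult_le_compat_l; lra). nra. }
    assert (Hlt : Cmod (wp y - w) <= (1 - t) * Cmod e + Cmod r).
    { replace (wp y - w)%C with (- (RtoC (1 - t) * e) + r)%C
        by (rewrite Ewy; unfold e; rewrite RtoC_minus; ring).
      eapply Rle_trans; [apply Cmod_triangle |].
      rewrite Cmod_opp, Cmod_mult, Cmod_R, Rabs_pos_eq; lra. }
    rewrite Cmod_minus_sym in Hy. fold e in Hy. nra.
Qed.

(** * Injectivity and the holomorphic inverse *)

(** For d = a + i b the square of the left side is (1 - exp a)^2 + 2 exp a (1 - cos b), and a <= 0
    bounds the two terms by a^2 and b^2. *)
Lemma Cexp_minus_1_le (d : C) : Re d <= 0 -> Cmod (1 - Cexp d) <= Cmod d.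
Proof.
  intros Hd. assert (E1 := Cmod2_alt (1 - Cexp d)). assert (E2 := Cmod2_alt d).
  unfold Cexp, Re, Im in *; simpl in *. set (a := fst d) in *. set (b := snd d) in *.
  assert (T := sin2_cos2 b). unfold Rsqr in T. assert (B := one_minus_cos_bound b). simpl in B.
  assert (H1 := exp_ineq1_le a). assert (Hp := exp_pos a).
  assert (H2 : exp a <= 1).
  { destruct Hd as [Hd | ->]; [| rewrite exp_0; lra].
    rewrite <- exp_0. left; now apply exp_increasing. }
  assert (Hn := Cmod_ge_0 d).
  assert (G1 : (1 - exp a) * (1 - exp a) <= a * a) by nra.
  assert (G2 : 2 * exp a * (1 - cos b) <= b * b) by nra.
  apply Rsqr_incr_0_var; trivial. unfold Rsqr. nra.
Qed.

(* For Re d <= 0, |exp d - 1| <= |d| bounds z2 (1 - exp d) in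
   z1 exp z1 - z2 exp z2 = exp z1 (- d + z2 (1 - exp d)), d = z2 - z1. *)
Lemma wp_expansive (z1 z2 : C) (rho : R) :
  rho <= 1 -> Cmod z1 <= rho -> Cmod z2 <= rho ->
  exp (-1) * (1 - rho) * Cmod (z1 - z2) <= Cmod (wp z1 - wp z2).
Proof.
  intros Hrho.
  assert (H : forall u v, Cmod u <= rho -> Cmod v <= rho -> Re (v - u)%C <= 0 ->
            exp (-1) * (1 - rho) * Cmod (u - v) <= Cmod (wp u - wp v)).
  { intros u v Hu Hv Hre. set (d := (v - u)%C) in *.
    replace (wp u - wp v)%C with (Cexp u * (v * (1 - Cexp d) - d))%C.
    - rewrite Cmod_mult, Cmod_Cexp, Cmod_minus_sym. fold d.
      assert (B := re_le_Cmod u). apply Rabs_le_between in B.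
      assert (He : exp (-1) <= exp (Re u)).
      { destruct (Req_dec (Re u) (-1)) as [-> | Hn]; [lra |].
        left; apply exp_increasing; lra. }
      assert (Hp := exp_pos (-1)).
      assert (H1 := Cmod_minus_triangle d (v * (1 - Cexp d))).
      rewrite Cmod_minus_sym, Cmod_mult in H1.
      assert (H2 := Cexp_minus_1_le d Hre). assert (Hd := Cmod_ge_0 d).
      assert (Hv0 := Cmod_ge_0 v). assert (H0 := Cmod_ge_0 (1 - Cexp d)).
      assert (H3 : Cmod v * Cmod (1 - Cexp d) <= rho * Cmod d) by (apply Rmult_le_compat; trivial).
      rewrite Rmult_assoc. apply Rmult_le_compat; try lra; try nra.
    - unfold wp. replace (Cexp v) with (Cexp u * Cexp d)%C
        by (rewrite <- Cexp_plus; f_equal; unfold d; ring).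
      unfold d. ring. }
  intros H1 H2. destruct (Rle_lt_dec (Re (z2 - z1)%C) 0) as [Hr | Hr]; [now apply H |].
  rewrite (Cmod_minus_sym z1), (Cmod_minus_sym (wp z1)). apply H; trivial.
  unfold Re in *; simpl in *. lra.
Qed.

(** Comparing slope functions in F(w(y)) = p(y) gives phi(w(y)) (w(y) - w(z)) = q(y) (y - z). So q /
    (phi o w) is a slope function for [w], and continuity of [w] at [z] is enough to make it
    continuous. *)
Lemma cdiff_left_inverse (F p w : C -> C) (z l p1 : C) (r : R) :
  0 < r -> (forall y, Cmod (y - z) < r -> F (w y) = p y) -> continuous w z ->
  cdiff F (w z) l -> l <> RtoC 0 -> cdiff p z p1 -> cdiff w z (p1 / l)%C.
Proof.
  intros Hr HF Cw [phi [Cphi [Ephi [d1 [Hd1 H1]]]]] Hl [q [Cq [Eq [d2 [Hd2 H2]]]]].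
  assert (Cc : continuous (fun y => phi (w y)) z) by now apply (continuous_comp w phi).
  destruct (proj1 (continuous_C_eps _ _) Cw d1 Hd1) as [d3 [Hd3 H3]].
  destruct (proj1 (continuous_C_eps _ _) Cc (Cmod l)) as [d4 [Hd4 H4]]; [now apply Cmod_gt_0 |].
  exists (fun y => q y * / phi (w y))%C. rewrite Ephi, Eq. repeat split.
  - apply continuous_Cmult; trivial. apply continuous_Cinv; trivial. now rewrite Ephi.
  - set (d := Rmin (Rmin r d2) (Rmin d3 d4)).
    assert (Hd : d <= Rmin r d2 /\ d <= Rmin d3 d4) by (split; [apply Rmin_l | apply Rmin_r]).
    assert (K1 := Rmin_l r d2). assert (K2 := Rmin_r r d2).
    assert (K3 := Rmin_l d3 d4). assert (K4 := Rmin_r d3 d4).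
    exists d; split; [unfold d; repeat apply Rmin_glb_lt; trivial |]. intros y Hy.
    specialize (H2 y ltac:(lra)). specialize (H3 y ltac:(lra)). specialize (H4 y ltac:(lra)).
    specialize (H1 (w y) H3). rewrite (HF y ltac:(lra)) in H1.
    assert (HFz : F (w z) = p z).
    { apply HF. replace (z - z)%C with (RtoC 0) by ring. now rewrite Cmod_0. }
    rewrite HFz, H2 in H1. rewrite Ephi in H4.
    assert (Hphi : phi (w y) <> RtoC 0).
    { intros E. rewrite E in H4. replace (0 - l)%C with (- l)%C in H4 by ring.
      rewrite Cmod_opp in H4. lra. }
    assert (E : (q y * (y - z))%C = (phi (w y) * (w y - w z))%C).
    { replace (q y * (y - z))%C with ((p z + q y * (y - z)) - p z)%C by ring. rewrite H1. ring. }
    replace (q y * / phi (w y) * (y - z))%C with (q y * (y - z) * / phi (w y))%C by ring.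
    rewrite E. field. trivial.
Qed.

(** [w] merely selects preimages. The expansion estimate bounds |w(y) - w(z)| by a multiple of |p(y)
    - p(z)|, which makes [w] continuous and hence, by [cdiff_left_inverse], holomorphic. *)
Lemma subordinate_wp_of_conic (k : R) (p : C -> C) :
  exp 1 - 1 <= k -> analytic_on_D p -> p (RtoC 0) = RtoC 1 ->
  (forall z, inD z -> k * Cmod (p z - 1) < Re (p z)) -> subordinate p wp.
Proof.
  intros Hk Hp Hp0 Hcon.
  set (w := fun z => epsilon (inhabits (RtoC 0)) (fun u => inD u /\ wp u = p z)).
  assert (Hw : forall z, inD z -> inD (w z) /\ wp (w z) = p z).
  { intros z Hz. apply (epsilon_spec (inhabits (RtoC 0)) (fun u => inD u /\ wp u = p z)).
    apply (wp_onto_conic k); auto. }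
  exists w. split; [| split; [| split]].
  - intros z Hz. apply ex_derive_cdiff.
    assert (Hpz := Hp z Hz). apply ex_derive_cdiff in Hpz. destruct Hpz as [p1 Hp1].
    assert (Cp := cdiff_continuous _ _ _ Hp1). destruct (Hw z Hz) as [Hwz Ewz].
    assert (Hc0 : conic_defect k (p z) < 0) by (specialize (Hcon z Hz); unfold conic_defect; lra).
    (* Near [z] the defect of [p] stays below half its negative value at [z], so all the selected
       preimages lie in one disk of radius [rho < 1]. *)
    destruct (conic_sublevel_in_smaller_disk k (conic_defect k (p z) / 2) Hk ltac:(lra))
      as [rho [Hrho Hin]].
    destruct (continuous_C_R_eps (fun y => conic_defect k (p y)) z) with
      (eps := - conic_defect k (p z) / 2) as [d [Hd Hd']]; [| lra |].
    { apply (continuous_comp p); [exact Cp | apply continuous_conic_defect]. }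
    assert (Hnear : forall y, Cmod (y - z) < Rmin d (1 - Cmod z) ->
              inD y /\ Cmod (w y) <= rho).
    { intros y Hy. assert (Hy1 := Rlt_le_trans _ _ _ Hy (Rmin_l _ _)).
      assert (Hy2 := Rlt_le_trans _ _ _ Hy (Rmin_r _ _)).
      assert (Hyd : inD y).
      { unfold inD. assert (T := Cmod_minus_triangle y z). lra. }
      split; trivial. destruct (Hw y Hyd) as [Hwy Ewy]. unfold inD in Hwy.
      apply Hin; [lra |]. rewrite Ewy. specialize (Hd' y Hy1). apply Rabs_def2 in Hd'. lra. }
    assert (Hr : 0 < Rmin d (1 - Cmod z)) by (apply Rmin_glb_lt; unfold inD in Hz; lra).
    assert (Hzz : Cmod (z - z) < Rmin d (1 - Cmod z))
      by (replace (z - z)%C with (RtoC 0) by ring; now rewrite Cmod_0).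
    eexists. apply (cdiff_left_inverse wp p w z ((1 + w z) * Cexp (w z))%C p1 _ Hr).
    + intros y Hy. apply Hw, Hnear, Hy.
    + apply continuous_C_eps. intros eps He.
      set (c := exp (-1) * (1 - rho)).
      assert (Hc : 0 < c) by (apply Rmult_lt_0_compat; [apply exp_pos | lra]).
      destruct (proj1 (continuous_C_eps _ _) Cp (c * eps)) as [d2 [Hd2 H2]];
        [now apply Rmult_lt_0_compat |].
      exists (Rmin d2 (Rmin d (1 - Cmod z))); split; [now apply Rmin_glb_lt |]. intros y Hy.
      specialize (H2 y (Rlt_le_trans _ _ _ Hy (Rmin_l _ _))).
      assert (Hy' := Rlt_le_trans _ _ _ Hy (Rmin_r _ _)).
      destruct (Hnear y Hy') as [HyD Hyr].
      assert (X := wp_expansive (w y) (w z) rho ltac:(lra) Hyr (proj2 (Hnear z Hzz))).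
      rewrite (proj2 (Hw y HyD)), Ewz in X. fold c in X.
      apply (Rmult_lt_reg_l c); trivial. lra.
    + apply cdiff_wp.
    + now apply wp_derivative_neq_0.
    + exact Hp1.
  - intros z Hz. now apply Hw.
  - assert (H0 : inD (RtoC 0)) by (unfold inD; rewrite Cmod_0; lra).
    destruct (Hw _ H0) as [Hw0 Ew0]. rewrite Hp0 in Ew0.
    (* Both [w 0] and 0 are mapped to 1; expansion on the disk of radius |w(0)| < 1 makes them
       equal. *)
    assert (X := wp_expansive (w (RtoC 0)) (RtoC 0) (Cmod (w (RtoC 0)))).
    unfold inD in Hw0. specialize (X ltac:(lra) ltac:(lra)).
    specialize (X ltac:(rewrite Cmod_0; apply Cmod_ge_0)).
    replace (wp (w (RtoC 0)) - wp (RtoC 0))%C with (RtoC 0) in X by (rewrite Ew0; unfold wp; ring).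
    replace (w (RtoC 0) - RtoC 0)%C with (w (RtoC 0)) in X by ring.
    rewrite Cmod_0 in X.
    apply Cmod_eq_0. apply Rle_antisym; [| apply Cmod_ge_0].
    assert (Hc : 0 < exp (-1) * (1 - Cmod (w (RtoC 0))))
      by (apply Rmult_lt_0_compat; [apply exp_pos | lra]).
    apply (Rmult_le_reg_l _ _ _ Hc). lra.
  - intros z Hz. symmetry. now apply Hw.
Qed.

(** * The inclusions between the function classes *)

Lemma S_wp_values (f : C -> C) : S_wp f ->
  forall z, inD z -> z <> RtoC 0 -> f z <> RtoC 0 /\ exists u, inD u /\ zq f z = wp u.
Proof.
  intros [_ [p [_ [Hp [w [_ [Hw [_ Hs]]]]]]]] z Hz Hz0.
  destruct (Hp z Hz Hz0) as [Hf Ep]. split; trivial.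
  exists (w z). split; [now apply Hw |]. rewrite <- Ep. now apply Hs.
Qed.

Lemma SS_star_starlike (gamma : R) (f : C -> C) : gamma <= 1 -> SS_star gamma f -> S_star f.
Proof.
  intros Hg [Hf H]. assert (Hpi := PI_RGT_0). split; trivial. intros z Hz Hz0.
  split; [now apply H |].
  destruct (zq_analytic_extension f Hf) as [p [Hp [Hp0 Ep]]].
  { intros y Hy Hy0. now apply H. }
  rewrite <- Ep by trivial.
  apply (Re_pos_of_nonneg p (Cderive p)); trivial.
  - intros y Hy. now apply Cderive_cdiff, Hp.
  - rewrite Hp0. unfold Re; simpl; lra.
  - intros y Hy. destruct (classic (y = RtoC 0)) as [-> | Hy0].
    + rewrite Hp0. unfold Re; simpl; lra.
    + rewrite Ep by trivial. apply Carg_right_half_plane.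
      destruct (H y Hy Hy0) as [_ Ha]. nra.
Qed.

Lemma k_ST_S_wp (k : R) (f : C -> C) : exp 1 - 1 <= k -> k_ST k f -> S_wp f.
Proof.
  intros Hk [Hf H]. split; trivial.
  destruct (zq_analytic_extension f Hf) as [p [Hp [Hp0 Ep]]].
  { intros y Hy Hy0. now apply H. }
  exists p. split; [exact Hp | split].
  - intros z Hz Hz0. split; [now apply H | now apply Ep].
  - apply (subordinate_wp_of_conic k); trivial. intros z Hz.
    destruct (classic (z = RtoC 0)) as [-> | Hz0].
    + rewrite Hp0. replace (1 - 1)%C with (RtoC 0) by ring. rewrite Cmod_0. unfold Re; simpl; lra.
    + rewrite Ep by trivial. now apply H.
Qed.

Theorem mainTheorem3 (w0 g0 b : R)
  (Hw0 : is_omega0 w0) (Hg0 : is_gamma0 g0) (Hb : is_bmax b) :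
  (* (i) *)
  (forall alpha, 0 <= alpha <= w0 ->
     (forall f, S_wp f -> S_star_alpha alpha f) /\
     (forall f, S_star_alpha alpha f -> S_star f)) /\
  (* (ii) *)
  (forall beta, 1 + exp 1 <= beta -> forall f, S_wp f -> M_beta beta f) /\
  (forall f, S_wp f -> S_star_alpha w0 f /\ M_beta (1 + exp 1) f) /\
  (* (iii) *)
  (forall gamma, g0 <= gamma <= 1 ->
     (forall f, S_wp f -> SS_star gamma f) /\
     (forall f, SS_star gamma f -> S_star f)) /\
  (* (iv) *)
  (forall a, b <= a -> forall f, S_wp f -> ST_p a f) /\
  (* (v) *)
  (forall k, exp 1 - 1 <= k -> forall f, k_ST k f -> S_wp f).
Proof.
  assert (Hpi := PI_RGT_0).
  assert (Halpha : forall alpha f, alpha <= w0 -> S_wp f -> S_star_alpha alpha f).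
  { intros alpha f Ha Hf. split; [apply Hf |]. intros z Hz Hz0.
    destruct (S_wp_values f Hf z Hz Hz0) as [Hn [u [Hu ->]]]. split; trivial.
    assert (H := Re_wp_gt_min w0 u Hw0 Hu). lra. }
  assert (Hbeta : forall beta f, 1 + exp 1 <= beta -> S_wp f -> M_beta beta f).
  { intros beta f Hbe Hf. split; [apply Hf |]. intros z Hz Hz0.
    destruct (S_wp_values f Hf z Hz Hz0) as [Hn [u [Hu ->]]]. split; trivial.
    assert (H := Re_wp_lt u Hu). lra. }
  split; [| split; [| split; [| split; [| split]]]].
  - intros alpha Ha. split; [intros f; apply Halpha; lra |].
    intros f [Hf H]. split; trivial. intros z Hz Hz0.
    destruct (H z Hz Hz0) as [Hn Hr]. split; trivial. lra.
  - intros beta Hbe f. now apply Hbeta.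
  - intros f Hf. split; [apply Halpha | apply Hbeta]; trivial; lra.
  - intros gamma Hg. split; [| intros f; apply SS_star_starlike; lra].
    intros f Hf. split; [apply Hf |]. intros z Hz Hz0.
    destruct (S_wp_values f Hf z Hz Hz0) as [Hn [u [Hu ->]]]. split; trivial.
    destruct (Carg_wp_not_max u Hu) as [y [Hy Hlt]].
    assert (Hsup := proj1 Hg0 (Rabs (Carg (wp y))) (ex_intro _ y (conj Hy eq_refl))). nra.
  - intros a Ha f Hf. split; [apply Hf |]. intros z Hz Hz0.
    destruct (S_wp_values f Hf z Hz Hz0) as [Hn [u [Hu ->]]]. split; trivial.
    assert (Hb0 := bmax_pos b Hb). apply parabola_focal; [lra |].
    now apply (wp_parabola a b).
  - intros k Hk f. now apply k_ST_S_wp.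
Qed.
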